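(* One has $$S_{\mathrm{BBG}} = M + R,\qquad M := \sum_{n=1}^{\infty}\frac{I_n}{n},\qquad R := \sum_{n=1}^{\infty}\frac{1}{n}\left[\left(\frac{2+\sin n}{3}\right)^{n}-I_n\right].$$ Both $M$ and $R$ are finite, and $$|R| \le C\sum_{n=1}^{\infty}\frac{(2/3)^n}{n}\cdot D^{*}\!\left(\left\lfloor\frac{n}{2\pi}\right\rfloor\right) < \infty,$$ where $C>0$ is an absolute constant.
   Context: $S_{\mathrm{BBG}} := \sum_{n=1}^{\infty}\frac1n\left(\frac{2+\sin n}{3}\right)^{n}$ (sine of the integer $n$ in radians). For $n\ge 0$, $I_n := \frac{1}{2\pi}\int_0^{2\pi}\left(\frac{2+\sin\theta}{3}\right)^{n}d\theta$. For points $x_1,\ldots,x_N\in[0,1)$, the star-discrepancy is $$D^{*}(N) := \sup_{0<\alpha\le 1}\left|\frac{\#\{1\le n\le N: x_n<\alpha\}}{N}-\alpha\right|.$$ Here $D^{*}(N)$ is taken for the sequence $x_n=\{n/(2\pi)\}$, where $\{x\}=x-\lfloor x\rfloor$ is the fractional part. *)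

(* Defs.v *)
(* Classical reals of the standard library, with Coquelicot. *)
From Stdlib Require Import Reals List ZArith.
From Coquelicot Require Import Coquelicot.
Local Open Scope R_scope.

(* Series are indexed from 1: the index [k] of Coquelicot's [Series] stands for
   n = k + 1. *)
Definition ex_series1 (a : nat -> R) : Prop := ex_series (fun k : nat => a (S k)).
Definition Series1 (a : nat -> R) : R := Series (fun k : nat => a (S k)).

Definition bbg_base (t : R) : R := (2 + sin t) / 3.

Definition bbg_term (n : nat) : R := 1 / INR n * bbg_base (INR n) ^ n.
Definition S_BBG : R := Series1 bbg_term.

Definition I_BBG (n : nat) : R :=
  1 / (2 * PI) * RInt (fun theta : R => bbg_base theta ^ n) 0 (2 * PI).

Definition main_term (n : nat) : R := I_BBG n / INR n.
Definition M_BBG : R := Series1 main_term.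

Definition rem_term (n : nat) : R := 1 / INR n * (bbg_base (INR n) ^ n - I_BBG n).
Definition R_BBG : R := Series1 rem_term.

(* #{1 <= n <= N : x n < alpha} *)
Definition count_below (x : nat -> R) (N : nat) (alpha : R) : nat :=
  length (filter (fun n : nat => if Rlt_dec (x n) alpha then true else false)
                 (seq 1 N)).

(* For N = 0 the quotient 0 / 0 is 0 in R, so that the supremum of alpha over
   (0, 1], the trivial value 1, is taken for an empty set of points. The set is
   nonempty and bounded, so [real] discards nothing. *)
Definition star_discrepancy (x : nat -> R) (N : nat) : R :=
  real (Lub_Rbar (fun y : R => exists alpha : R,
    0 < alpha <= 1 /\ y = Rabs (INR (count_below x N alpha) / INR N - alpha))).

Definition x_seq (n : nat) : R := frac_part (INR n / (2 * PI)).

Definition floor_over_2pi (n : nat) : nat := Z.to_nat (Int_part (INR n / (2 * PI))).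

Definition disc_term (n : nat) : R :=
  (2 / 3) ^ n / INR n * star_discrepancy x_seq (floor_over_2pi n).

(* Main.v *)
Require Import Defs.
From Stdlib Require Import Reals List ZArith Lra Lia.
From Coquelicot Require Import Coquelicot.
Local Open Scope R_scope.

(** The point is the convergence of the three series; once they converge,
    the decomposition is linearity, and the constant in the last inequality may
    depend on [R_BBG], because [Series1 disc_term] is positive (its first term
    involves the discrepancy of an empty set of points, which is 1).

    The series of the means converges because [I_BBG n] is of order
    n^(-1/2): near its maximum at pi/2 the integrand is below
    1 / (1 + n d^2 / 121), d being the distance to pi/2, and this integrates to
    an arctangent ([I_BBG_bounds]).

    The series [bbg_term] is more delicate, since a term is as large as 1/n
    when n is very close to pi/2 modulo 2 pi. Call n a peak when
    ((2 + sin n)/3)^n > 1/n; the other terms are below 1/n^2. If n and n + g are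
    peaks between 2^k and 2^(k+1), both are near pi/2 modulo 2 pi, so
    1 - cos g = O(k 2^(-k)): g is exponentially close to a multiple of 2 pi.
    A lower bound for the distance from g to 2 pi Z forces g to be large, hence
    the peaks to be sparse. If peaks in the k-th dyadic block are at least
    G(k) apart, their reciprocals sum to at most 1/G(k) + 2^(-k), and it is
    enough that the sum of 1/G(k) converges; G(k) of order k^(3/2) is what is
    obtained ([peak_spacing], [peak_block_sum]).

    The bound that this takes, |g - 2 pi b| >= exp(-C s^4) for g <= s^6
    ([dist_multiple_two_pi]), is stronger than the one given by the usual
    integral of Niven, which would lose the convergence by a logarithm. It
    comes from Hermite-Pade approximation to 1, cos and sin, here in the form
    of a single series
      sum_j (-1)^j Q(2j) (2 pi)^(2j) / (2j)!,
      Q(k) = prod_(i=1)^(2 nu) (k - 2 nu - 2 i).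
    - As Q is an integer polynomial of degree 2 nu, Q(x d/dx) cos x is a
      combination of x^i cos x and x^i sin x with integer coefficients, so the
      whole sum is an integer polynomial of degree 2 nu in 2 pi
      ([is_series_cos_polynomial]).
    - The terms j <= nu have integer coefficients too, because (2j)! divides
      Q(2j) ([fact_divides_even_product]), and those with nu < j <= 3 nu vanish.
    - The rest decays geometrically, so it is comparable to its first term,
      which is not zero and of order (2 nu)! C^nu / (6 nu)!.
    Hence an integer polynomial of degree 2 nu has a tiny nonzero value at
    2 pi, known up to a factor. Were g/b too close to 2 pi, its value at g/b
    would still be nonzero and below b^(-2 nu), as soon as nu is a large multiple of
    sqrt b; multiplied by b^(2 nu) it would be an integer strictly between 0
    and 1 in absolute value ([two_pi_rational_gap]). *)

(** * Real series *)

Lemma is_series_Rmult_l : forall (c : R) (a : nat -> R) (l : R),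
  is_series a l -> is_series (fun n => c * a n) (c * l).
Proof. intros c a l H. exact (is_series_scal_l c a l H). Qed.

Lemma is_series_pointwise : forall (a b : nat -> R) (l : R),
  (forall n, a n = b n) -> is_series a l -> is_series b l.
Proof. intros a b l E H. exact (is_series_ext a b l E H). Qed.

Lemma is_series_drop_zero : forall (a : nat -> R) (l : R),
  a O = 0 -> is_series (fun n => a (S n)) l -> is_series a l.
Proof.
  intros a l H0 H. apply is_series_decr_1. rewrite H0.
  unfold plus, opp; simpl. now rewrite Ropp_0, Rplus_0_r.
Qed.

(** * Series of cosine type at 2 pi *)

Fixpoint falling (i : nat) (z : R) : R :=
  match i with O => 1 | S j => falling j z * (z - INR j) end.

Fixpoint even_product (d : nat) (z : R) : R :=
  match d with O => 1 | S e => even_product e z * (z - 2 * INR (S e)) end.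

Definition cos_taylor (x : R) (j : nat) : R :=
  (-1) ^ j / INR (fact (2 * j)) * x ^ (2 * j).

Lemma falling_shift : forall i z, falling (S i) (z + 1) = (z + 1) * falling i z.
Proof.
  induction i as [|i IH]; intros z.
  - simpl. ring.
  - change (falling (S (S i)) (z + 1))
      with (falling (S i) (z + 1) * (z + 1 - INR (S i))).
    rewrite IH, S_INR. simpl. ring.
Qed.

Lemma even_product_shift : forall d z,
  even_product d (z + 2) * (z - 2 * INR d) = z * even_product d z.
Proof.
  induction d as [|d IH]; intros z.
  - simpl. ring.
  - change (even_product (S d) (z + 2))
      with (even_product d (z + 2) * (z + 2 - 2 * INR (S d))).
    change (even_product (S d) z) with (even_product d z * (z - 2 * INR (S d))).
    replace (z + 2 - 2 * INR (S d)) with (z - 2 * INR d)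
      by (rewrite S_INR; ring).
    rewrite IH. ring.
Qed.

(** The recurrence is kept free of division, so that it combines with those of
    [falling] and [even_product] by ring manipulations. *)
Lemma cos_taylor_S : forall x j,
  (2 * INR j + 2) * (2 * INR j + 1) * cos_taylor x (S j) = - x ^ 2 * cos_taylor x j.
Proof.
  intros x j. unfold cos_taylor.
  replace (2 * S j)%nat with (S (S (2 * j))) by lia.
  rewrite !fact_simpl, !mult_INR, !S_INR, mult_INR.
  assert (H := INR_fact_neq_0 (2 * j)). assert (Hj := pos_INR j).
  simpl (INR 2). simpl pow. field. repeat split; try lra.
Qed.

Lemma is_series_cos_taylor : forall x, is_series (cos_taylor x) (cos x).
Proof.
  intros x. unfold cos. destruct (exist_cos (Rsqr x)) as [l Hl].
  apply is_series_Reals in Hl. eapply is_series_pointwise; [|exact Hl].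
  intros n. simpl. unfold cos_taylor, cos_n, Rsqr.
  rewrite pow_mult. simpl (x ^ 2). now rewrite Rmult_1_r.
Qed.

Lemma is_series_cos_taylor_index : forall x,
  is_series (fun j => 2 * INR j * cos_taylor x j) (- x * sin x).
Proof.
  intros x. apply is_series_drop_zero; [simpl; ring|].
  assert (H : is_series (fun n => (-x) * (x * (sin_n n * (x * x) ^ n))) (- x * sin x)).
  { apply is_series_Rmult_l. unfold sin. destruct (exist_sin (Rsqr x)) as [l Hl].
    apply is_series_Reals in Hl. apply (is_series_Rmult_l x) in Hl. exact Hl. }
  eapply is_series_pointwise; [|exact H].
  intros j. simpl. unfold sin_n.
  assert (E := cos_taylor_S x j). unfold cos_taylor in E at 2.
  rewrite pow_mult in E.
  replace (2 * j + 1)%nat with (S (2 * j)) by lia.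
  rewrite fact_simpl, mult_INR, S_INR, mult_INR. simpl (INR 2).
  assert (Hf := INR_fact_neq_0 (2 * j)). assert (Hj := pos_INR j).
  simpl (x ^ 2) in E.
  replace (match j with 0%nat => 1 | S _ => INR j + 1 end) with (INR j + 1)
    by (destruct j; simpl; lra).
  apply (Rmult_eq_reg_r (2 * INR j + 1)); [|lra].
  replace (2 * (INR j + 1) * cos_taylor x (S j) * (2 * INR j + 1))
   with ((2 * INR j + 2) * (2 * INR j + 1) * cos_taylor x (S j)) by ring.
  rewrite E. rewrite Rmult_1_r. field. split; [exact Hf|lra].
Qed.

(** The sum is x^i times the i-th derivative of the cosine, whose value at 2 pi is
    0, 1 or -1. Passing from i to i + 2 shifts the series by one index and
    multiplies it by - x^2, which reduces everything to i = 0 and i = 1. *)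
Lemma is_series_falling_cos : forall i, exists z : Z, (Z.abs z <= 1)%Z /\
  is_series (fun j => falling i (2 * INR j) * cos_taylor (2 * PI) j)
            (IZR z * (2 * PI) ^ i).
Proof.
  assert (H : forall i, (exists z : Z, (Z.abs z <= 1)%Z /\
    is_series (fun j => falling i (2 * INR j) * cos_taylor (2 * PI) j)
              (IZR z * (2 * PI) ^ i)) /\
    (exists z : Z, (Z.abs z <= 1)%Z /\
    is_series (fun j => falling (S i) (2 * INR j) * cos_taylor (2 * PI) j)
              (IZR z * (2 * PI) ^ (S i)))).
  2:{ intros i. apply H. }
  induction i as [|i [IH1 IH2]].
  - split.
    + exists 1%Z. split; [lia|].
      eapply is_series_pointwise with (a := cos_taylor (2 * PI)).
      * intros n. simpl. ring.
      * replace (IZR 1 * (2 * PI) ^ 0) with (cos (2 * PI)) by (rewrite cos_2PI; simpl; ring).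
        apply is_series_cos_taylor.
    + exists 0%Z. split; [lia|].
      eapply is_series_pointwise with (a := fun j => 2 * INR j * cos_taylor (2 * PI) j).
      * intros n. simpl. ring.
      * replace (IZR 0 * (2 * PI) ^ 1) with (- (2 * PI) * sin (2 * PI))
          by (rewrite sin_2PI; simpl; ring).
        apply is_series_cos_taylor_index.
  - split; [exact IH2|].
    destruct IH1 as [z [Hz IH1]]. exists (- z)%Z. split; [lia|].
    apply is_series_drop_zero.
    + replace (2 * INR 0) with 0 by (simpl; ring).
      assert (F0 : falling (S (S i)) 0 = 0).
      { clear. induction i as [|i IH]; [simpl; ring|].
        change (falling (S (S (S i))) 0) with (falling (S (S i)) 0 * (0 - INR (S (S i)))).
        rewrite IH. ring. }
      rewrite F0. ring.
    + replace (IZR (- z) * (2 * PI) ^ S (S i))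
        with (- (2 * PI) ^ 2 * (IZR z * (2 * PI) ^ i)) by (rewrite opp_IZR; simpl; ring).
      eapply is_series_pointwise; [|apply is_series_Rmult_l; exact IH1].
      intros j. cbn beta.
      replace (2 * INR (S j)) with (2 * INR j + 1 + 1) by (rewrite S_INR; ring).
      rewrite !falling_shift.
      assert (E := cos_taylor_S (2 * PI) j).
      transitivity (falling i (2 * INR j) * (- (2 * PI) ^ 2 * cos_taylor (2 * PI) j)).
      ring.
      rewrite <- E. ring.
Qed.

(** Stands for: f is a polynomial with integer coefficients of degree at most D,
    L being computed from a bound on the coefficients. The two consequences recorded here,
    a denominator dividing b^D at g/b and a Lipschitz constant near 2 pi, are all
    that the approximation argument uses, and both are stable under integer
    combinations, which avoids handling coefficients. *)
Definition int_poly_like (D : nat) (L : R) (f : R -> R) : Prop :=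
  (forall g b : nat, (1 <= b)%nat ->
     exists z : Z, INR b ^ D * f (INR g / INR b) = IZR z) /\
  (forall y y', Rabs y <= 8 -> Rabs y' <= 8 ->
     Rabs (f y - f y') <= L * Rabs (y - y')).

Lemma int_poly_like_plus : forall D L L' f f',
  int_poly_like D L f -> int_poly_like D L' f' ->
  int_poly_like D (L + L') (fun y => f y + f' y).
Proof.
  intros D L L' f f' [A B] [A' B']. split.
  - intros g b Hb. destruct (A g b Hb) as [z Hz]. destruct (A' g b Hb) as [z' Hz'].
    exists (z + z')%Z. rewrite plus_IZR, <- Hz, <- Hz'. ring.
  - intros y y' Hy Hy'.
    replace (f y + f' y - (f y' + f' y')) with ((f y - f y') + (f' y - f' y')) by ring.
    eapply Rle_trans; [apply Rabs_triang|].
    specialize (B y y' Hy Hy'). specialize (B' y y' Hy Hy'). lra.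
Qed.

Lemma int_poly_like_scal : forall D L f (c : Z),
  int_poly_like D L f -> int_poly_like D (IZR (Z.abs c) * L) (fun y => IZR c * f y).
Proof.
  intros D L f c [A B]. split.
  - intros g b Hb. destruct (A g b Hb) as [z Hz].
    exists (c * z)%Z. rewrite mult_IZR, <- Hz. ring.
  - intros y y' Hy Hy'. rewrite <- Rmult_minus_distr_l, Rabs_mult, abs_IZR, Rmult_assoc.
    apply Rmult_le_compat_l; [apply Rabs_pos|now apply B].
Qed.

Lemma int_poly_like_weaken : forall D L L' f,
  L <= L' -> int_poly_like D L f -> int_poly_like D L' f.
Proof.
  intros D L L' f HL [A B]. split; [exact A|].
  intros y y' Hy Hy'. eapply Rle_trans; [now apply B|].
  apply Rmult_le_compat_r; [apply Rabs_pos|exact HL].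
Qed.

Lemma pow_lipschitz : forall i y y', Rabs y <= 8 -> Rabs y' <= 8 ->
  Rabs (y ^ i - y' ^ i) <= INR i * 8 ^ i * Rabs (y - y').
Proof.
  induction i as [|i IH]; intros y y' Hy Hy'.
  - simpl. rewrite Rminus_diag, Rabs_R0. lra.
  - replace (y ^ S i - y' ^ S i) with (y * (y ^ i - y' ^ i) + (y - y') * y' ^ i)
      by (simpl; ring).
    eapply Rle_trans; [apply Rabs_triang|]. rewrite !Rabs_mult.
    specialize (IH y y' Hy Hy').
    assert (P : Rabs (y' ^ i) <= 8 ^ i).
    { rewrite <- RPow_abs. apply pow_incr. split; [apply Rabs_pos|exact Hy']. }
    assert (Q := Rabs_pos (y - y')). assert (Q8 : 0 < 8 ^ i) by (apply pow_lt; lra).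
    assert (Rabs y * Rabs (y ^ i - y' ^ i) <= 8 * (INR i * 8 ^ i * Rabs (y - y'))).
    { apply Rmult_le_compat; auto using Rabs_pos. }
    assert (Rabs (y - y') * Rabs (y' ^ i) <= Rabs (y - y') * 8 ^ i).
    { apply Rmult_le_compat_l; auto. }
    rewrite S_INR. simpl pow.
    assert (0 <= Rabs (y - y') * 8 ^ i) by (apply Rmult_le_pos; lra).
    lra.
Qed.

Lemma int_poly_like_pow : forall D i, (i <= D)%nat ->
  int_poly_like D (INR D * 8 ^ D) (fun y => y ^ i).
Proof.
  intros D i Hi. split.
  - intros g b Hb. assert (0 < INR b) by (apply lt_0_INR; lia).
    exists (Z.of_nat b ^ Z.of_nat (D - i) * Z.of_nat g ^ Z.of_nat i)%Z.
    rewrite mult_IZR, <- !pow_IZR, <- !INR_IZR_INZ.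
    replace D with ((D - i) + i)%nat at 1 by lia.
    unfold Rdiv. rewrite pow_add, Rpow_mult_distr, pow_inv. field.
    apply pow_nonzero. lra.
  - intros y y' Hy Hy'. eapply Rle_trans; [now apply pow_lipschitz|].
    apply Rmult_le_compat_r; [apply Rabs_pos|].
    apply Rmult_le_compat; [apply pos_INR|apply pow_le; lra|now apply le_INR|].
    apply Rle_pow; [lra|exact Hi].
Qed.

(** Each linear factor 2 j - r of the product is absorbed by
    (k - r) k(k-1)...(k-i+1) = k(k-1)...(k-i) + (i - r) k(k-1)...(k-i+1),
    so the induction has to run over all i at once. With d = 2 nu and i = 0 this
    is the full series of the approximation argument. *)
Lemma is_series_cos_polynomial : forall nu d i, (i + d <= 2 * nu)%nat ->
  exists f, int_poly_like (2 * nu)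
              (INR (2 * nu) * 8 ^ (2 * nu) * INR (6 * nu + 1) ^ d) f /\
    is_series (fun j => falling i (2 * INR j) * even_product d (2 * INR j - 2 * INR nu)
                        * cos_taylor (2 * PI) j) (f (2 * PI)).
Proof.
  intros nu. induction d as [|d IH]; intros i Hi.
  - destruct (is_series_falling_cos i) as [z [Hz S]].
    exists (fun y => IZR z * y ^ i). split.
    + eapply int_poly_like_weaken; [|apply int_poly_like_scal, (int_poly_like_pow (2 * nu) i)].
      2: lia.
      apply IZR_le in Hz. rewrite pow_O, Rmult_1_r.
      rewrite <- (Rmult_1_l (INR (2 * nu) * 8 ^ (2 * nu))) at 2.
      apply Rmult_le_compat_r; [|exact Hz].
      apply Rmult_le_pos; [apply pos_INR|apply pow_le; lra].
    + eapply is_series_pointwise; [|exact S]. intros n. simpl. ring.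
  - destruct (IH (S i)) as [f1 [P1 S1]]; [lia|].
    destruct (IH i) as [f0 [P0 S0]]; [lia|].
    (* i minus the root 2 nu + 2 (d + 1) contributed by the last factor *)
    set (c := (Z.of_nat i - Z.of_nat (2 * nu + 2 * S d))%Z).
    exists (fun y => f1 y + IZR c * f0 y). split.
    + eapply int_poly_like_weaken;
        [|apply int_poly_like_plus; [exact P1|apply int_poly_like_scal; exact P0]].
      assert (Hc : IZR (Z.abs c) <= INR (6 * nu)).
      { rewrite INR_IZR_INZ. apply IZR_le. unfold c. lia. }
      set (X := INR (2 * nu) * 8 ^ (2 * nu) * INR (6 * nu + 1) ^ d).
      assert (HX : 0 <= X).
      { unfold X. repeat apply Rmult_le_pos; try apply pos_INR; apply pow_le;
          [lra|apply pos_INR]. }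
      replace (INR (2 * nu) * 8 ^ (2 * nu) * INR (6 * nu + 1) ^ S d)
        with (INR (6 * nu + 1) * X) by (unfold X; rewrite <- (tech_pow_Rmult _ d); ring).
      rewrite (plus_INR _ 1). simpl (INR 1). nra.
    + eapply is_series_pointwise;
        [|exact (is_series_plus _ _ _ _ S1 (is_series_Rmult_l (IZR c) _ _ S0))].
      intros j. unfold plus, scal, mult; simpl. unfold mult; simpl.
      unfold c. rewrite minus_IZR, <- !INR_IZR_INZ, plus_INR, !mult_INR.
      change (INR 2) with 2. change (match d with 0%nat => 1 | S _ => INR d + 1 end) with (INR (S d)).
      ring.
Qed.

(** * Products of integers and factorials *)

Lemma exp_le_exp : forall x y, x <= y -> exp x <= exp y.
Proof.
  intros x y [H| ->]; [left; now apply exp_increasing|right; reflexivity].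
Qed.

Lemma fact_le_pow : forall n, (fact n <= n ^ n)%nat.
Proof.
  assert (H : forall m n, (n <= m)%nat -> (fact n <= m ^ n)%nat).
  { intros m. induction n as [|n IH]; intros Hn; [simpl; lia|].
    rewrite fact_simpl, Nat.pow_succ_r'. apply Nat.mul_le_mono; [lia|apply IH; lia]. }
  intros n. now apply H.
Qed.

(** The product of the d integers following m. *)
Fixpoint rising (d m : nat) : nat :=
  match d with O => 1%nat | S e => (rising e m * (m + S e))%nat end.

Lemma rising_shift : forall d m, (S m * rising d (S m) = rising (S d) m)%nat.
Proof.
  induction d as [|d IH]; intros m; [simpl; lia|].
  change (rising (S d) (S m)) with (rising d (S m) * (S m + S d))%nat.
  change (rising (S (S d)) m) with (rising (S d) m * (m + S (S d)))%nat.
  rewrite <- IH. ring.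
Qed.

(** Integrality of binomial coefficients, by Pascal's rule. *)
Lemma fact_divides_rising : forall d m, exists q, rising d m = (q * fact d)%nat.
Proof.
  induction d as [|d IHd]; intros m; [exists 1%nat; reflexivity|].
  induction m as [|m [q Hq]].
  - exists 1%nat. clear IHd. rewrite Nat.mul_1_l.
    induction d as [|d IH]; [reflexivity|].
    change (rising (S (S d)) 0) with (rising (S d) 0 * S (S d))%nat.
    rewrite IH, (fact_simpl (S d)). ring.
  - destruct (IHd (S m)) as [p Hp]. exists (q + p)%nat.
    change (rising (S d) (S m)) with (rising d (S m) * (S m + S d))%nat.
    transitivity (S m * rising d (S m) + S d * rising d (S m))%nat; [ring|].
    rewrite rising_shift, Hq, Hp, fact_simpl. ring.
Qed.

Lemma fact_divides_fact : forall m k, exists q, fact (m + k) = (q * fact m)%nat.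
Proof.
  intros m. induction k as [|k [q Hq]].
  - exists 1%nat. rewrite Nat.add_0_r. ring.
  - exists (S (m + k) * q)%nat. rewrite Nat.add_succ_r, fact_simpl, Hq. ring.
Qed.

Lemma rising_le : forall d m, (rising d m <= (m + d) ^ d)%nat.
Proof.
  induction d as [|d IH]; intros m; [simpl; lia|].
  change (rising (S d) m) with (rising d m * (m + S d))%nat.
  rewrite Nat.pow_succ_r', Nat.mul_comm. apply Nat.mul_le_mono_l.
  eapply Nat.le_trans; [apply IH|]. apply Nat.pow_le_mono_l. lia.
Qed.

Lemma even_product_neg : forall d m,
  even_product d (- 2 * INR m) = (-2) ^ d * INR (rising d m).
Proof.
  induction d as [|d IH]; intros m; [simpl; ring|].
  change (even_product (S d) (- 2 * INR m))
    with (even_product d (- 2 * INR m) * (- 2 * INR m - 2 * INR (S d))).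
  change (rising (S d) m) with (rising d m * (m + S d))%nat.
  rewrite IH, mult_INR, plus_INR. simpl pow. ring.
Qed.

Lemma even_product_zero : forall d m, (1 <= m <= d)%nat ->
  even_product d (2 * INR m) = 0.
Proof.
  induction d as [|d IH]; intros m Hm; [lia|].
  change (even_product (S d) (2 * INR m))
    with (even_product d (2 * INR m) * (2 * INR m - 2 * INR (S d))).
  destruct (Nat.eq_dec m (S d)) as [->|H]; [ring|].
  rewrite IH by lia. ring.
Qed.

Lemma even_product_bounds : forall d z, 2 * INR d + 1 <= z ->
  1 <= even_product d z <= (z - 2) ^ d.
Proof.
  induction d as [|d IH]; intros z Hz; [simpl; lra|].
  rewrite S_INR in Hz. assert (Hd := pos_INR d).
  destruct (IH z) as [A B]; [lra|].
  change (even_product (S d) z) with (even_product d z * (z - 2 * INR (S d))).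
  rewrite S_INR. simpl pow. split; [nra|].
  rewrite Rmult_comm. apply Rmult_le_compat; lra.
Qed.

(** For j <= nu the factors are 2 nu consecutive integers, doubled and negated,
    so (2 nu)! divides the product, hence (2 j)! does. Without this divisibility
    one would have to multiply by (2 nu)!, which would spoil the size
    estimates. *)
Lemma fact_divides_even_product : forall nu j, (j <= nu)%nat ->
  exists c : Z,
    even_product (2 * nu) (2 * INR j - 2 * INR nu) = IZR c * INR (fact (2 * j)) /\
    IZR (Z.abs c) <= INR (6 * nu) ^ (2 * nu).
Proof.
  intros nu j Hj.
  replace (2 * INR j - 2 * INR nu) with (- 2 * INR (nu - j))
    by (rewrite minus_INR by lia; ring).
  rewrite even_product_neg.
  assert (Hb : Rabs ((-2) ^ (2 * nu) * INR (rising (2 * nu) (nu - j)))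
               <= INR (6 * nu) ^ (2 * nu)).
  { rewrite Rabs_mult, <- RPow_abs, (Rabs_left (-2)) by lra.
    rewrite (Rabs_pos_eq (INR _)) by apply pos_INR.
    apply Rle_trans with (2 ^ (2 * nu) * INR (3 * nu) ^ (2 * nu)).
    - replace (- -2) with 2 by ring. apply Rmult_le_compat_l; [apply pow_le; lra|].
      rewrite <- pow_INR. apply le_INR. eapply Nat.le_trans; [apply rising_le|].
      apply Nat.pow_le_mono_l. lia.
    - rewrite <- Rpow_mult_distr. replace (2 * INR (3 * nu)) with (INR (6 * nu)).
      + lra.
      + rewrite !mult_INR. simpl. ring. }
  destruct (fact_divides_rising (2 * nu) (nu - j)) as [q Hq].
  destruct (fact_divides_fact (2 * j) (2 * nu - 2 * j)) as [p Hp].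
  replace (2 * j + (2 * nu - 2 * j))%nat with (2 * nu)%nat in Hp by lia.
  rewrite Hq, Hp in Hb |- *.
  exists ((-2) ^ Z.of_nat (2 * nu) * Z.of_nat q * Z.of_nat p)%Z.
  set (c := ((-2) ^ Z.of_nat (2 * nu) * Z.of_nat q * Z.of_nat p)%Z).
  assert (E : (-2) ^ (2 * nu) * INR (q * (p * fact (2 * j))) = IZR c * INR (fact (2 * j))).
  { unfold c. rewrite !mult_IZR, <- pow_IZR, <- !INR_IZR_INZ, !mult_INR. ring. }
  split; [exact E|].
  eapply Rle_trans; [|exact Hb]. rewrite E, Rabs_mult, abs_IZR.
  rewrite (Rabs_pos_eq (INR _)) by apply pos_INR.
  assert (1 <= INR (fact (2 * j))).
  { apply (le_INR 1). apply lt_O_fact. }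
  assert (0 <= Rabs (IZR c)) by apply Rabs_pos. nra.
Qed.

(** * Small values of integer polynomials at 2 pi *)

(** The factor vanishes for nu < j <= 3 nu. This gap separates the initial terms,
    which form an integer polynomial in 2 pi, from a very small tail. *)
Definition cut_term (nu j : nat) : R :=
  even_product (2 * nu) (2 * INR j - 2 * INR nu) * cos_taylor (2 * PI) j.

Lemma int_poly_like_initial : forall nu n, (n <= 3 * nu)%nat ->
  exists f, int_poly_like (2 * nu)
      (INR (S n) * (INR (6 * nu) ^ (2 * nu) * (INR (2 * nu) * 8 ^ (2 * nu)))) f /\
    sum_n (cut_term nu) n = f (2 * PI).
Proof.
  intros nu. set (X := INR (6 * nu) ^ (2 * nu) * (INR (2 * nu) * 8 ^ (2 * nu))).
  assert (HT : forall j, (j <= 3 * nu)%nat ->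
    exists f, int_poly_like (2 * nu) X f /\ cut_term nu j = f (2 * PI)).
  { intros j Hj. destruct (le_lt_dec j nu) as [H|H].
    - destruct (fact_divides_even_product nu j H) as [c [Hc Hb]].
      exists (fun y => IZR (c * (-1) ^ Z.of_nat j) * y ^ (2 * j)). split.
      + eapply int_poly_like_weaken;
          [|apply int_poly_like_scal, (int_poly_like_pow (2 * nu) (2 * j)); lia].
        unfold X. apply Rmult_le_compat_r.
        * apply Rmult_le_pos; [apply pos_INR|apply pow_le; lra].
        * rewrite Z.abs_mul, Z.abs_pow. change (Z.abs (-1)) with 1%Z.
          rewrite Z.pow_1_l by lia. now rewrite Z.mul_1_r.
      + unfold cut_term, cos_taylor. rewrite Hc, mult_IZR, <- pow_IZR. field.
        apply INR_fact_neq_0.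
    - exists (fun y => IZR 0 * y ^ 0). split.
      + eapply int_poly_like_weaken;
          [|apply int_poly_like_scal, (int_poly_like_pow (2 * nu) 0); lia].
        simpl (IZR (Z.abs 0)). rewrite Rmult_0_l. unfold X.
        repeat apply Rmult_le_pos; try apply pos_INR; apply pow_le;
          [apply pos_INR|lra].
      + unfold cut_term. replace (2 * INR j - 2 * INR nu) with (2 * INR (j - nu))
          by (rewrite minus_INR by lia; ring).
        rewrite even_product_zero by lia. ring. }
  induction n as [|n IH]; intros Hn.
  - destruct (HT 0%nat) as [f [A B]]; [lia|]. exists f. split.
    + simpl INR at 1. now rewrite Rmult_1_l.
    + now rewrite sum_O.
  - destruct (HT (S n) Hn) as [f [A B]]. destruct IH as [f' [A' B']]; [lia|].
    exists (fun y => f' y + f y). split.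
    + replace (INR (S (S n)) * X) with (INR (S n) * X + X)
        by (rewrite (S_INR (S n)); ring).
      now apply int_poly_like_plus.
    + rewrite sum_Sn, B, B'. reflexivity.
Qed.

(** A series decreasing this fast is comparable to its first term, so a lower
    bound for the sum comes for free, whatever the signs. *)
Lemma geometric_tail : forall (b : nat -> R) (t : R),
  (forall l, Rabs (b (S l)) <= / 4 * Rabs (b l)) -> is_series b t ->
  Rabs (t - b O) <= Rabs (b O) / 3.
Proof.
  intros b t Hb Ht.
  assert (G : forall l, Rabs (b l) <= Rabs (b O) * (/ 4) ^ l).
  { induction l as [|l IH]; [simpl; lra|].
    eapply Rle_trans; [apply Hb|]. simpl pow. lra. }
  assert (Hg : is_series (fun l => Rabs (b O) / 4 * (/ 4) ^ l) (Rabs (b O) / 3)).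
  { replace (Rabs (b O) / 3) with (Rabs (b O) / 4 * / (1 - / 4)) by field.
    apply is_series_Rmult_l, is_series_geom. rewrite Rabs_pos_eq; lra. }
  assert (Hc : forall l, Rabs (b (S l)) <= Rabs (b O) / 4 * (/ 4) ^ l).
  { intros l. eapply Rle_trans; [apply G|]. simpl pow. lra. }
  assert (Hs : is_series (fun l => b (S l)) (t - b O)).
  { apply is_series_incr_1. unfold plus; simpl.
    now replace (t - b O + b O) with t by ring. }
  assert (Ha : ex_series (fun l => Rabs (b (S l)))).
  { apply (ex_series_le (V := R_CompleteNormedModule) _ (fun l => Rabs (b O) / 4 * (/ 4) ^ l)).
    - intros l. unfold norm; simpl. unfold abs; simpl. rewrite Rabs_Rabsolu. apply Hc.
    - eexists; exact Hg. }
  rewrite <- (is_series_unique _ _ Hs), <- (is_series_unique _ _ Hg).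
  eapply Rle_trans; [now apply Series_Rabs|].
  apply Series_le; [|eexists; exact Hg].
  intros l. split; [apply Rabs_pos|apply Hc].
Qed.

Lemma cut_term_ratio : forall nu l, (16 <= nu)%nat ->
  Rabs (cut_term nu (3 * nu + 1 + S l)) <= / 4 * Rabs (cut_term nu (3 * nu + 1 + l)).
Proof.
  intros nu l Hnu. set (j := (3 * nu + 1 + l)%nat).
  replace (3 * nu + 1 + S l)%nat with (S j) by (unfold j; lia).
  assert (Hj : INR j = 3 * INR nu + 1 + INR l).
  { unfold j. rewrite !plus_INR, mult_INR. simpl. ring. }
  assert (Hn : 16 <= INR nu) by (apply (le_INR 16) in Hnu; simpl in Hnu; lra).
  assert (Hl := pos_INR l).
  assert (E : (2 * INR j - 6 * INR nu) * ((2 * INR j + 2) * (2 * INR j + 1))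
              * cut_term nu (S j)
            = - ((2 * PI) ^ 2 * (2 * INR j - 2 * INR nu) * cut_term nu j)).
  { unfold cut_term.
    assert (E1 := cos_taylor_S (2 * PI) j).
    assert (E2 := even_product_shift (2 * nu) (2 * INR j - 2 * INR nu)).
    rewrite mult_INR in E2. simpl (INR 2) in E2.
    replace (2 * INR (S j) - 2 * INR nu) with (2 * INR j - 2 * INR nu + 2)
      by (rewrite S_INR; ring).
    transitivity ((even_product (2 * nu) (2 * INR j - 2 * INR nu + 2) *
      (2 * INR j - 2 * INR nu - 2 * (2 * INR nu))) *
      ((2 * INR j + 2) * (2 * INR j + 1) * cos_taylor (2 * PI) (S j))); [ring|].
    rewrite E1. replace (1 + 1) with 2 in E2 by ring. rewrite E2. ring. }
  apply (f_equal Rabs) in E. rewrite Rabs_Ropp, !Rabs_mult in E.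
  rewrite (Rabs_pos_eq (2 * INR j - 6 * INR nu)) in E by lra.
  rewrite (Rabs_pos_eq (2 * INR j - 2 * INR nu)) in E by lra.
  rewrite (Rabs_pos_eq (2 * INR j + 2)) in E by lra.
  rewrite (Rabs_pos_eq (2 * INR j + 1)) in E by lra.
  assert (HP : 0 <= (2 * PI) ^ 2 <= 64).
  { assert (P0 := PI_RGT_0). assert (P4 := PI_4). split; nra. }
  rewrite (Rabs_pos_eq ((2 * PI) ^ 2)) in E by lra.
  set (A := Rabs (cut_term nu (S j))) in *. set (B := Rabs (cut_term nu j)) in *.
  assert (HB : 0 <= B) by apply Rabs_pos.
  rewrite Hj in E.
  replace (2 * (3 * INR nu + 1 + INR l) - 6 * INR nu) with (2 * (1 + INR l)) in E by ring.
  set (n := INR nu) in *. set (L := INR l) in *.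
  set (Y := 2 * (1 + L) * ((2 * (3 * n + 1 + L) + 2) * (2 * (3 * n + 1 + L) + 1))) in *.
  assert (HY : 256 * (2 * (3 * n + 1 + L) - 2 * n) <= Y).
  { unfold Y. assert (36 * (n * n) <= (2 * (3 * n + 1 + L) + 2) * (2 * (3 * n + 1 + L) + 1)) by nra.
    (* this is where nu >= 16 matters *)
    assert (256 * (2 * n + 1) <= 36 * (n * n)) by nra.
    apply Rle_trans with (2 * (1 + L) * (256 * (2 * n + 1))); [nra|].
    apply Rmult_le_compat_l; lra. }
  assert (HY0 : 0 < Y) by lra.
  apply (Rmult_le_reg_l Y); [exact HY0|]. rewrite E.
  assert (0 <= (2 * (3 * n + 1 + L) - 2 * n)) by lra.
  assert ((2 * PI) ^ 2 * (2 * (3 * n + 1 + L) - 2 * n) <= 64 * (2 * (3 * n + 1 + L) - 2 * n)).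
  { apply Rmult_le_compat_r; lra. }
  assert ((2 * PI) ^ 2 * (2 * (3 * n + 1 + L) - 2 * n) * B <= / 4 * Y * B).
  { apply Rmult_le_compat_r; lra. }
  lra.
Qed.

(** The Lipschitz constant on [-8, 8] of the polynomial whose value at 2 pi is the
    tail: the full sum contributes the first summand, the 3 nu + 1 initial terms
    the second. *)
Definition tail_lipschitz (nu : nat) : R :=
  INR (2 * nu) * 8 ^ (2 * nu) *
  (INR (6 * nu + 1) ^ (2 * nu) + INR (3 * nu + 1) * INR (6 * nu) ^ (2 * nu)).

Lemma small_int_poly : forall nu, (16 <= nu)%nat ->
  exists f, int_poly_like (2 * nu) (tail_lipschitz nu) f /\
    Rabs (f (2 * PI) - cut_term nu (3 * nu + 1))
      <= Rabs (cut_term nu (3 * nu + 1)) / 3.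
Proof.
  intros nu Hnu.
  destruct (is_series_cos_polynomial nu (2 * nu) 0) as [f1 [P1 S1]]; [lia|].
  destruct (int_poly_like_initial nu (3 * nu)) as [f2 [P2 S2]]; [lia|].
  exists (fun y => f1 y + IZR (-1) * f2 y). split.
  - eapply int_poly_like_weaken;
      [|apply int_poly_like_plus; [exact P1|apply int_poly_like_scal; exact P2]].
    unfold tail_lipschitz. simpl (IZR (Z.abs (-1))).
    replace (S (3 * nu)) with (3 * nu + 1)%nat by lia. right. ring.
  - assert (H : is_series (cut_term nu) (f1 (2 * PI))).
    { eapply is_series_pointwise; [|exact S1]. intros n. unfold cut_term. simpl falling. ring. }
    assert (HT : is_series (fun l => cut_term nu (3 * nu + 1 + l))
                           (f1 (2 * PI) + -1 * f2 (2 * PI))).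
    { apply (is_series_incr_n (cut_term nu) (3 * nu + 1)); [lia|].
      replace (Init.Nat.pred (3 * nu + 1)) with (3 * nu)%nat by lia.
      change (is_series (cut_term nu)
        (f1 (2 * PI) + -1 * f2 (2 * PI) + sum_n (cut_term nu) (3 * nu))).
      rewrite S2.
      now replace (f1 (2 * PI) + -1 * f2 (2 * PI) + f2 (2 * PI)) with (f1 (2 * PI)) by ring. }
    assert (R := geometric_tail (fun l => cut_term nu (3 * nu + 1 + l)) _
      (fun l => cut_term_ratio nu l Hnu) HT).
    cbv beta in R. rewrite Nat.add_0_r in R. exact R.
Qed.

(** By induction, from (1 + 1/n)^n <= e <= 3. *)
Lemma pow_self_le_fact : forall n, INR n ^ n <= 3 ^ n * INR (fact n).
Proof.
  induction n as [|n IH]; [simpl; lra|].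
  destruct n as [|n]; [simpl; lra|].
  set (m := S n) in *. assert (Hm : 1 <= INR m) by (apply (le_INR 1); unfold m; lia).
  assert (H : INR (S m) ^ m <= 3 * INR m ^ m).
  { replace (INR (S m)) with ((1 + / INR m) * INR m) by (rewrite S_INR; field; lra).
    rewrite Rpow_mult_distr. apply Rmult_le_compat_r; [apply pow_le; lra|].
    apply Rle_trans with (exp (/ INR m) ^ m).
    - apply pow_incr. assert (0 < / INR m) by (apply Rinv_0_lt_compat; lra).
      split; [lra|]. apply exp_ineq1_le.
    - rewrite <- Rpower_pow by apply exp_pos. unfold Rpower. rewrite ln_exp.
      replace (INR m * / INR m) with 1 by (field; lra). apply exp_le_3. }
  rewrite fact_simpl, mult_INR.
  rewrite <- (tech_pow_Rmult (INR (S m)) m), <- (tech_pow_Rmult 3 m).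
  assert (0 < INR (S m)) by (apply lt_0_INR; lia).
  apply Rle_trans with (INR (S m) * (3 * (3 ^ m * INR (fact m)))); [|right; ring].
  apply Rmult_le_compat_l; lra.
Qed.

Lemma cut_term_bounds : forall nu, (1 <= nu)%nat ->
  / INR (fact (6 * nu + 2)) <= Rabs (cut_term nu (3 * nu + 1)) /\
  Rabs (cut_term nu (3 * nu + 1)) <= (4 * INR nu) ^ (2 * nu) * (4 / INR nu) ^ (6 * nu + 2).
Proof.
  intros nu Hnu. assert (Hn : 1 <= INR nu) by (apply (le_INR 1); lia).
  assert (Hf := INR_fact_lt_0 (6 * nu + 2)).
  assert (E : Rabs (cut_term nu (3 * nu + 1)) =
    even_product (2 * nu) (4 * INR nu + 2) * ((2 * PI) ^ (6 * nu + 2) / INR (fact (6 * nu + 2)))).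
  { unfold cut_term, cos_taylor.
    replace (2 * (3 * nu + 1))%nat with (6 * nu + 2)%nat by lia.
    replace (2 * INR (3 * nu + 1) - 2 * INR nu) with (4 * INR nu + 2)
      by (rewrite plus_INR, mult_INR; simpl; ring).
    destruct (even_product_bounds (2 * nu) (4 * INR nu + 2)) as [A _].
    { rewrite mult_INR. simpl. lra. }
    unfold Rdiv. rewrite !Rabs_mult, pow_1_abs, Rabs_inv, <- RPow_abs.
    rewrite (Rabs_pos_eq (even_product _ _)) by lra.
    rewrite (Rabs_pos_eq (2 * PI)) by (assert (H := PI_RGT_0); lra).
    rewrite (Rabs_pos_eq (INR _)) by lra. ring. }
  destruct (even_product_bounds (2 * nu) (4 * INR nu + 2)) as [A B].
  { rewrite mult_INR. simpl. lra. }
  replace (4 * INR nu + 2 - 2) with (4 * INR nu) in B by ring.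
  assert (P4 := PI_4). assert (P3 := PI2_3_2).
  rewrite E. split.
  - assert (1 <= (2 * PI) ^ (6 * nu + 2)) by (apply pow_R1_Rle; lra).
    assert (0 < / INR (fact (6 * nu + 2))) by now apply Rinv_0_lt_compat.
    unfold Rdiv. set (I := / INR (fact (6 * nu + 2))) in *.
    set (P := (2 * PI) ^ (6 * nu + 2)) in *. assert (I <= P * I) by nra. nra.
  - apply Rmult_le_compat; [lra| |exact B|].
    + apply Rmult_le_pos; [apply pow_le; lra|left; now apply Rinv_0_lt_compat].
    + set (M := (6 * nu + 2)%nat).
      assert (HM := pow_self_le_fact M).
      assert (HM6 : (6 * INR nu) ^ M <= INR M ^ M).
      { apply pow_incr. unfold M. rewrite plus_INR, mult_INR. simpl. lra. }
      apply Rle_trans with (8 ^ M / INR (fact M)).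
      * apply Rmult_le_compat_r; [left; now apply Rinv_0_lt_compat|].
        apply pow_incr. lra.
      * apply (Rmult_le_reg_r (INR (fact M))); [exact Hf|].
        replace (8 ^ M / INR (fact M) * INR (fact M)) with (8 ^ M) by (field; unfold M; lra).
        replace 8 with (4 / INR nu * (6 * INR nu) * / 3) by (field; lra).
        rewrite !Rpow_mult_distr, Rmult_assoc. apply Rmult_le_compat_l.
        { apply pow_le. apply Rmult_le_pos; [lra|left; apply Rinv_0_lt_compat; lra]. }
        rewrite pow_inv. apply (Rmult_le_reg_r (3 ^ M)); [apply pow_lt; lra|].
        rewrite Rmult_assoc, Rinv_l by (apply pow_nonzero; lra).
        rewrite Rmult_1_r, (Rmult_comm (INR _)), <- Rpow_mult_distr. lra.
Qed.

(** The upper bound of [cut_term_bounds] times b^(2 nu) equals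
    (256 b / nu^2)^(2 nu) (4 / nu)^2, so nu has to be of order sqrt b. *)
Lemma cut_term_small : forall nu b, (16 <= nu)%nat -> (256 * b <= nu * nu)%nat ->
  INR b ^ (2 * nu) * Rabs (cut_term nu (3 * nu + 1)) <= / 16.
Proof.
  intros nu b Hnu Hb.
  destruct (cut_term_bounds nu) as [_ U]; [lia|].
  assert (Hn : 16 <= INR nu) by (apply (le_INR 16) in Hnu; simpl in Hnu; lra).
  apply le_INR in Hb. rewrite !mult_INR in Hb. replace (INR 256) with 256 in Hb by (simpl; lra).
  assert (Hb0 := pos_INR b).
  eapply Rle_trans; [apply Rmult_le_compat_l; [apply pow_le; exact Hb0|exact U]|].
  replace (6 * nu + 2)%nat with (3 * (2 * nu) + 2)%nat by lia.
  rewrite pow_add, (pow_mult _ 3), <- !Rmult_assoc, <- !Rpow_mult_distr.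
  replace (INR b * (4 * INR nu) * (4 / INR nu) ^ 3) with (256 * INR b / (INR nu * INR nu))
    by (field; lra).
  assert (H1 : 0 <= (256 * INR b / (INR nu * INR nu)) ^ (2 * nu) <= 1).
  { assert (0 < / (INR nu * INR nu)) by (apply Rinv_0_lt_compat; nra).
    assert (H2 : 0 <= 256 * INR b / (INR nu * INR nu) <= 1).
    { split; [apply Rmult_le_pos; lra|].
      apply (Rmult_le_reg_r (INR nu * INR nu)); [nra|].
      unfold Rdiv. rewrite Rmult_assoc, Rinv_l by nra. lra. }
    split; [apply pow_le; lra|].
    rewrite <- (pow1 (2 * nu)). apply pow_incr. lra. }
  assert (H2 : 0 <= (4 / INR nu) ^ 2 <= / 16).
  { assert (0 <= 4 / INR nu <= / 4).
    { split; [apply Rmult_le_pos; [lra|left; apply Rinv_0_lt_compat; lra]|].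
      apply (Rmult_le_reg_r (INR nu)); [lra|].
      unfold Rdiv. rewrite Rmult_assoc, Rinv_l by lra. lra. }
    split; nra. }
  nra.
Qed.

(** If g/b were closer to 2 pi, the Lipschitz bound would move the value of the
    small polynomial by less than a third of the leading tail term, leaving it
    nonzero; then b^(2 nu) times the value at g/b would be an integer of absolute
    value strictly between 0 and 1. *)
Lemma two_pi_rational_gap : forall nu g b,
  (16 <= nu)%nat -> (1 <= b)%nat -> (256 * b <= nu * nu)%nat -> (g <= 8 * b)%nat ->
  1 <= 3 * tail_lipschitz nu * INR (fact (6 * nu + 2)) * Rabs (INR g / INR b - 2 * PI).
Proof.
  intros nu g b Hnu Hb Hbn Hg. apply Rnot_lt_le. intros Hlt.
  destruct (small_int_poly nu Hnu) as [f [[Hint Hlip] Hf]].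
  destruct (cut_term_bounds nu) as [Hlow _]; [lia|].
  assert (Hup := cut_term_small nu b Hnu Hbn).
  set (t := cut_term nu (3 * nu + 1)) in *. set (F := INR (fact (6 * nu + 2))) in *.
  assert (HF : 0 < F) by apply INR_fact_lt_0.
  assert (Hb0 : 1 <= INR b) by (apply (le_INR 1); lia).
  assert (Hy : Rabs (INR g / INR b) <= 8).
  { rewrite Rabs_pos_eq by (apply Rmult_le_pos; [apply pos_INR|left; apply Rinv_0_lt_compat; lra]).
    apply (Rmult_le_reg_r (INR b)); [lra|]. unfold Rdiv. rewrite Rmult_assoc, Rinv_l by lra.
    apply le_INR in Hg. rewrite mult_INR in Hg. simpl in Hg. lra. }
  assert (Hp : Rabs (2 * PI) <= 8).
  { assert (P0 := PI_RGT_0). assert (P4 := PI_4). rewrite Rabs_pos_eq; lra. }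
  specialize (Hlip _ _ Hy Hp). destruct (Hint g b Hb) as [z Hz].
  set (d := Rabs (INR g / INR b - 2 * PI)) in *.
  assert (Hd : 3 * (tail_lipschitz nu * d) < Rabs t).
  { apply Rlt_le_trans with (/ F); [|exact Hlow].
    apply (Rmult_lt_reg_r F); [exact HF|]. rewrite Rinv_l by lra. lra. }
  set (w := f (INR g / INR b)) in *.
  assert (Hw : Rabs (w - t) < 2 * Rabs t / 3).
  { replace (w - t) with ((w - f (2 * PI)) + (f (2 * PI) - t)) by ring.
    eapply Rle_lt_trans; [apply Rabs_triang|]. lra. }
  assert (Ht : 0 < Rabs t) by (assert (H := Rinv_0_lt_compat F HF); lra).
  assert (Hw1 : 0 < Rabs w <= 2 * Rabs t).
  { split.
    - assert (T := Rabs_triang_inv t (t - w)). rewrite (Rabs_minus_sym t w) in T.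
      replace (t - (t - w)) with w in T by ring. lra.
    - assert (T := Rabs_triang t (w - t)). replace (t + (w - t)) with w in T by ring.
      assert (P := Rabs_pos t). lra. }
  assert (Hbp : 1 <= INR b ^ (2 * nu)) by now apply pow_R1_Rle.
  assert (Hzw : Rabs (IZR z) = INR b ^ (2 * nu) * Rabs w).
  { rewrite <- Hz, Rabs_mult, (Rabs_pos_eq (INR b ^ _)) by lra. reflexivity. }
  assert (Hz1 : 0 < Rabs (IZR z) < 1) by (rewrite Hzw; nra).
  rewrite <- abs_IZR in Hz1. destruct Hz1 as [Z0 Z1].
  apply lt_IZR in Z0. apply lt_IZR in Z1. lia.
Qed.

Lemma pow_le_exp : forall x y n, 0 <= x -> x <= exp y -> x ^ n <= exp (INR n * y).
Proof.
  intros x y n H0 H. apply Rle_trans with (exp y ^ n); [now apply pow_incr|].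
  rewrite <- Rpower_pow by apply exp_pos. unfold Rpower. rewrite ln_exp. lra.
Qed.

(** Every quantity involved is at most Y = 64 nu = 1024 s^3, or a power of it with
    exponent at most 6 nu + 2; altogether Y^(16 nu), and Y <= exp (13 s). *)
Lemma tail_lipschitz_bound : forall s, (1 <= s)%nat ->
  3 * tail_lipschitz (16 * s ^ 3) * INR (fact (6 * (16 * s ^ 3) + 2))
    <= exp (3328 * INR s ^ 4).
Proof.
  intros s Hs. set (nu := (16 * s ^ 3)%nat).
  assert (Hs3 : (1 <= s ^ 3)%nat) by (change 1%nat with (1 ^ 3)%nat; now apply Nat.pow_le_mono_l).
  assert (Hnu : (16 <= nu)%nat) by (unfold nu; lia).
  assert (Hn : 16 <= INR nu) by (apply (le_INR 16) in Hnu; simpl in Hnu; lra).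
  set (Y := 64 * INR nu).
  assert (HY : 1 <= Y) by (unfold Y; lra).
  assert (C : forall a c, (a * nu + c <= 64 * nu)%nat -> 0 <= INR (a * nu + c) <= Y).
  { intros a c H. split; [apply pos_INR|]. unfold Y.
    replace (64 * INR nu) with (INR (64 * nu)) by (rewrite mult_INR; simpl; ring).
    now apply le_INR. }
  assert (HL : 3 * tail_lipschitz nu * INR (fact (6 * nu + 2)) <= Y ^ (16 * nu)).
  { apply Rle_trans with (Y * (Y * Y ^ (2 * nu) * (Y * Y * Y ^ (2 * nu))) * Y ^ (6 * nu + 2)).
    - assert (C2 := C 2%nat 0%nat ltac:(lia)). assert (C6 := C 6%nat 0%nat ltac:(lia)).
      rewrite Nat.add_0_r in C2, C6.
      assert (C1 := C 6%nat 1%nat ltac:(lia)). assert (C3 := C 3%nat 1%nat ltac:(lia)).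
      assert (C8 := C 6%nat 2%nat ltac:(lia)).
      assert (HT : 0 <= tail_lipschitz nu <= Y * Y ^ (2 * nu) * (Y * Y * Y ^ (2 * nu))).
      { assert (E8 : 0 <= 8 ^ (2 * nu) <= Y ^ (2 * nu)).
        { split; [apply pow_le; lra|apply pow_incr; unfold Y; lra]. }
        assert (E1 : 0 <= INR (6 * nu + 1) ^ (2 * nu) <= Y ^ (2 * nu)).
        { split; [apply pow_le; lra|apply pow_incr; lra]. }
        assert (E6 : 0 <= INR (6 * nu) ^ (2 * nu) <= Y ^ (2 * nu)).
        { split; [apply pow_le; lra|apply pow_incr; lra]. }
        assert (E36 : 0 <= INR (3 * nu + 1) * INR (6 * nu) ^ (2 * nu) <= INR (3 * nu + 1) * Y ^ (2 * nu)).
        { split; [apply Rmult_le_pos; lra|apply Rmult_le_compat_l; lra]. }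
        assert (E9 : (1 + INR (3 * nu + 1)) * Y ^ (2 * nu) <= Y * Y * Y ^ (2 * nu)).
        { apply Rmult_le_compat_r; [lra|]. assert (1024 <= Y) by (unfold Y; lra). nra. }
        unfold tail_lipschitz. split.
        - repeat apply Rmult_le_pos; lra.
        - apply Rmult_le_compat; [apply Rmult_le_pos; lra|lra| |lra].
          apply Rmult_le_compat; lra. }
      assert (HF : 0 <= INR (fact (6 * nu + 2)) <= Y ^ (6 * nu + 2)).
      { split; [apply pos_INR|]. apply Rle_trans with (INR (6 * nu + 2) ^ (6 * nu + 2)).
        - rewrite <- pow_INR. apply le_INR. apply fact_le_pow.
        - apply pow_incr. lra. }
      apply Rmult_le_compat; [apply Rmult_le_pos; lra|lra| |lra].
      apply Rmult_le_compat; try lra. unfold Y; lra.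
    - apply Rle_trans with (Y ^ (10 * nu + 6)); [|apply Rle_pow; [exact HY|lia]].
      replace (10 * nu + 6)%nat with (1 + (1 + 2 * nu + (1 + 1 + 2 * nu)) + (6 * nu + 2))%nat by lia.
      rewrite !pow_add. rewrite pow_1. right. ring. }
  eapply Rle_trans; [exact HL|].
  assert (Hs1 : 1 <= INR s) by now apply (le_INR 1).
  assert (E : exp 1 >= 2) by (assert (H := exp_ineq1_le 1); lra).
  assert (HYe : Y <= exp (13 * INR s)).
  { unfold Y, nu. rewrite mult_INR, pow_INR. replace (INR 16) with 16 by (simpl; lra).
    replace (64 * (16 * INR s ^ 3)) with (2 ^ 10 * INR s ^ 3) by ring.
    apply Rle_trans with (exp (INR 10 * 1) * exp (INR 3 * INR s)).
    - apply Rmult_le_compat; [apply pow_le; lra|apply pow_le; lra| |].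
      + apply pow_le_exp; lra.
      + apply pow_le_exp; [lra|]. assert (H := exp_ineq1_le (INR s)). lra.
    - rewrite <- exp_plus. apply exp_le_exp. simpl. lra. }
  eapply Rle_trans; [apply pow_le_exp; [|exact HYe]; lra|].
  apply exp_le_exp. unfold nu. rewrite !mult_INR, pow_INR. simpl. right. ring.
Qed.

(** The choice nu = 16 s^3 gives nu^2 = 256 s^6 >= 256 b, and nu log nu is
    O(s^4). Any exponent strictly between 3 and 6 in place of 4 would do for the
    convergence of the series. *)
Lemma dist_multiple_two_pi : forall s g b, (1 <= s)%nat -> (1 <= b)%nat ->
  (1 <= g <= s ^ 6)%nat ->
  exp (- (3328 * INR s ^ 4)) <= Rabs (INR g - 2 * PI * INR b).
Proof.
  intros s g b Hs Hb Hg. apply Rnot_lt_le. intros Hlt.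
  assert (P4 := PI_4). assert (P3 := PI2_3_2).
  assert (Hb0 : 1 <= INR b) by now apply (le_INR 1).
  assert (Hsr : 1 <= INR s) by now apply (le_INR 1).
  assert (H1 : exp (- (3328 * INR s ^ 4)) <= 1).
  { rewrite <- exp_0. apply exp_le_exp. assert (0 < INR s ^ 4) by (apply pow_lt; lra). lra. }
  assert (Hab : - 1 < INR g - 2 * PI * INR b < 1) by (apply Rabs_def2 in Hlt; lra).
  assert (Hbg : (b <= g)%nat).
  { apply INR_le. nra. }
  assert (Hgb : (g <= 8 * b + 1)%nat).
  { apply INR_le. rewrite plus_INR, mult_INR. simpl. nra. }
  assert (Hgb8 : (g <= 8 * b)%nat).
  { destruct (Nat.eq_dec g (8 * b + 1)) as [->|]; [|lia].
    rewrite plus_INR, mult_INR in Hab. simpl in Hab. nra. }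
  assert (Hs3 : (1 <= s ^ 3)%nat) by (change 1%nat with (1 ^ 3)%nat; now apply Nat.pow_le_mono_l).
  assert (Hgap := two_pi_rational_gap (16 * s ^ 3) g b ltac:(lia) Hb).
  assert (Hbs : (256 * b <= 16 * s ^ 3 * (16 * s ^ 3))%nat).
  { replace (s ^ 6)%nat with (s ^ 3 * s ^ 3)%nat in Hg by (rewrite <- Nat.pow_add_r; reflexivity).
    nia. }
  specialize (Hgap Hbs Hgb8).
  assert (HB := tail_lipschitz_bound s Hs).
  set (K := 3 * tail_lipschitz (16 * s ^ 3) * INR (fact (6 * (16 * s ^ 3) + 2))) in *.
  replace (INR g / INR b - 2 * PI) with ((INR g - 2 * PI * INR b) / INR b) in Hgap
    by (field; lra).
  unfold Rdiv in Hgap. rewrite Rabs_mult, Rabs_inv, (Rabs_pos_eq (INR b)) in Hgap by lra.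
  set (e := Rabs (INR g - 2 * PI * INR b)) in *.
  assert (He : 0 <= e) by apply Rabs_pos.
  assert (Hib : 0 < / INR b <= 1).
  { split; [apply Rinv_0_lt_compat; lra|]. rewrite <- Rinv_1. apply Rinv_le_contravar; lra. }
  rewrite exp_Ropp in Hlt.
  set (X := exp (3328 * INR s ^ 4)) in *. assert (HX : 0 < X) by apply exp_pos.
  assert (e * / INR b <= e) by nra.
  assert (0 <= e * / INR b) by nra.
  assert (X * e < 1).
  { apply (Rmult_lt_compat_l X) in Hlt; [|exact HX]. rewrite Rinv_r in Hlt by lra. exact Hlt. }
  assert (K * (e * / INR b) <= X * e) by nra.
  lra.
Qed.

(** * Sparsity of the peaks *)

Lemma sin_ge_third : forall t, 0 <= t <= 2 -> t / 3 <= sin t.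
Proof.
  intros t Ht. destruct (pre_sin_bound t 0) as [H _]; [lra|lra|].
  eapply Rle_trans; [|exact H]. unfold sin_approx, sin_term. simpl.
  assert (t * t <= 4) by nra. nra.
Qed.

Lemma one_minus_cos_ge : forall r, Rabs r <= PI -> r ^ 2 / 18 <= 1 - cos r.
Proof.
  intros r Hr.
  assert (H : forall x, 0 <= x <= PI -> x ^ 2 / 18 <= 1 - cos x).
  { intros x Hx. assert (P4 := PI_4).
    assert (S := sin_ge_third (x / 2) ltac:(lra)).
    assert (E : cos x = 1 - 2 * sin (x / 2) * sin (x / 2)).
    { rewrite <- cos_2a_sin. f_equal. field. }
    rewrite E. nra. }
  unfold Rabs in Hr. destruct (Rcase_abs r).
  - rewrite <- cos_neg. replace (r ^ 2) with ((- r) ^ 2) by ring. apply H. lra.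
  - apply H. lra.
Qed.

Lemma nearest_multiple_two_pi : forall x, 0 <= x ->
  exists b : nat, Rabs (x - 2 * PI * INR b) <= PI.
Proof.
  intros x Hx. assert (P0 := PI_RGT_0).
  destruct (base_Int_part (x / (2 * PI) + / 2)) as [A B].
  set (z := Int_part (x / (2 * PI) + / 2)) in *.
  assert (Hq : 0 <= x / (2 * PI)) by (apply Rmult_le_pos; [lra|left; apply Rinv_0_lt_compat; lra]).
  assert (Hz : (0 <= z)%Z).
  { assert (-1 < IZR z) by lra. apply lt_IZR in H. lia. }
  exists (Z.to_nat z). rewrite INR_IZR_INZ, Z2Nat.id by exact Hz.
  assert (E : x = 2 * PI * (x / (2 * PI))) by (field; lra).
  set (q := x / (2 * PI)) in *. rewrite E. apply Rabs_le. nra.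
Qed.

Lemma one_minus_cos_nat_ge : forall s g, (1 <= s)%nat -> (1 <= g <= s ^ 6)%nat ->
  exp (- (6656 * INR s ^ 4)) / 18 <= 1 - cos (INR g).
Proof.
  intros s g Hs Hg.
  destruct (nearest_multiple_two_pi (INR g) (pos_INR g)) as [b Hb].
  assert (Hlow : exp (- (3328 * INR s ^ 4)) <= Rabs (INR g - 2 * PI * INR b)).
  { destruct b as [|b].
    - simpl (INR 0). rewrite Rmult_0_r, Rminus_0_r, Rabs_pos_eq by apply pos_INR.
      apply Rle_trans with 1; [|now apply (le_INR 1)].
      rewrite <- exp_0. apply exp_le_exp.
      assert (0 <= INR s ^ 4) by (apply pow_le, pos_INR). lra.
    - apply dist_multiple_two_pi; [exact Hs|lia|exact Hg]. }
  replace (cos (INR g)) with (cos (INR g - 2 * PI * INR b)).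
  2:{ rewrite <- (cos_period (INR g - 2 * PI * INR b) b). f_equal. ring. }
  eapply Rle_trans; [|now apply one_minus_cos_ge].
  rewrite <- pow2_abs.
  replace (- (6656 * INR s ^ 4)) with (- (3328 * INR s ^ 4) + - (3328 * INR s ^ 4)) by ring.
  rewrite exp_plus. assert (0 < exp (- (3328 * INR s ^ 4))) by apply exp_pos. nra.
Qed.

(** With P, Q the points of the unit circle at angles x, y and T its top,
    |P - Q|^2 <= 2 |P - T|^2 + 2 |Q - T|^2. *)
Lemma one_minus_cos_sub_le : forall x y,
  1 - cos (x - y) <= 2 * (1 - sin x) + 2 * (1 - sin y).
Proof.
  intros x y. rewrite cos_minus.
  assert (A := sin2_cos2 x). assert (B := sin2_cos2 y). unfold Rsqr in A, B.
  assert (0 <= (cos x + cos y) ^ 2) by apply pow2_ge_0.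
  assert (0 <= (sin x + sin y - 2) ^ 2) by apply pow2_ge_0.
  nra.
Qed.

Lemma bbg_base_range : forall t, / 3 <= bbg_base t <= 1.
Proof. intros t. unfold bbg_base. assert (H := SIN_bound t). lra. Qed.

(** Since (1 - u)^n <= exp(- n u), a peak has n u < log n, where
    u = (1 - sin n)/3. *)
Lemma peak_near_top : forall n k, (2 ^ k <= n < 2 ^ S k)%nat ->
  / INR n < bbg_base (INR n) ^ n -> 1 - sin (INR n) <= 3 * (INR k + 1) / 2 ^ k.
Proof.
  intros n k [H1 H2] Hp.
  assert (Hk : (1 <= 2 ^ k)%nat) by (assert (H := Nat.pow_nonzero 2 k); lia).
  apply le_INR in H1. apply lt_INR in H2. rewrite !pow_INR in H1, H2. simpl (INR 2) in H1, H2.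
  replace (1 + 1) with 2 in * by ring.
  assert (H2k : 0 < 2 ^ k) by (apply pow_lt; lra).
  set (u := (1 - sin (INR n)) / 3).
  assert (Hu : bbg_base (INR n) = 1 + - u) by (unfold bbg_base, u; field).
  assert (Hu0 : 0 <= u) by (unfold u; assert (H := SIN_bound (INR n)); lra).
  assert (HE : bbg_base (INR n) ^ n <= exp (INR n * - u)).
  { apply pow_le_exp; [assert (H := bbg_base_range (INR n)); lra|].
    rewrite Hu. apply exp_ineq1_le. }
  assert (HI : exp (- (INR (S k) * 1)) <= / INR n).
  { rewrite exp_Ropp. apply Rinv_le_contravar; [lra|].
    apply Rle_trans with (2 ^ S k); [lra|]. apply pow_le_exp; [lra|].
    assert (H := exp_ineq1_le 1). lra. }
  assert (HL : - (INR (S k) * 1) < INR n * - u) by (apply exp_lt_inv; lra).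
  rewrite S_INR in HL.
  assert (HL2 : 2 ^ k * u <= INR k + 1) by nra.
  replace (1 - sin (INR n)) with (3 * u) by (unfold u; field).
  apply (Rmult_le_reg_r (2 ^ k)); [exact H2k|].
  replace (3 * (INR k + 1) / 2 ^ k * 2 ^ k) with (3 * (INR k + 1)) by (field; lra). lra.
Qed.

(** Two peaks at distance g <= s^6 in the k-th dyadic block would give
    exp(- 6656 s^4) <= 216 (k + 1) / 2^k. The constant 164^2 = 26896 exceeds
    4 * 6656, so that the left side is at least exp(- k/4); it is a square so
    that the square root taken in [peak_block_sum] is exact. *)
Lemma peak_spacing : forall s k n g, (164 * 164 * s ^ 4 <= k)%nat ->
  (2 ^ k <= n)%nat -> (n + g < 2 ^ S k)%nat -> (1 <= g)%nat ->
  / INR n < bbg_base (INR n) ^ n ->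
  / INR (n + g) < bbg_base (INR (n + g)) ^ (n + g) -> (s ^ 6 < g)%nat.
Proof.
  intros s k n g Hk Hn Hng Hg Pn Png.
  destruct (le_lt_dec g (s ^ 6)) as [Hle|]; [exfalso|assumption].
  assert (Hs : (1 <= s)%nat).
  { destruct s; [simpl in Hle; lia|lia]. }
  assert (T1 := peak_near_top n k ltac:(lia) Pn).
  assert (T2 := peak_near_top (n + g) k ltac:(lia) Png).
  assert (C := one_minus_cos_sub_le (INR (n + g)) (INR n)).
  replace (INR (n + g) - INR n) with (INR g) in C by (rewrite plus_INR; ring).
  assert (D := one_minus_cos_nat_ge s g Hs ltac:(lia)).
  assert (Hs4 : (1 <= s ^ 4)%nat) by (change 1%nat with (1 ^ 4)%nat; now apply Nat.pow_le_mono_l).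
  assert (Hkr : 164 * 164 * INR s ^ 4 <= INR k).
  { apply le_INR in Hk. rewrite !mult_INR, pow_INR in Hk.
    rewrite (INR_IZR_INZ 164) in Hk. exact Hk. }
  assert (Hs4r : 1 <= INR s ^ 4) by (rewrite <- pow_INR; now apply (le_INR 1)).
  assert (H2k : 0 < 2 ^ k) by (apply pow_lt; lra).
  set (x := INR k) in *.
  assert (E1 : exp (- (x / 4)) <= exp (- (6656 * INR s ^ 4))) by (apply exp_le_exp; lra).
  assert (E2 : exp (x / 2) <= 2 ^ k).
  { replace (x / 2) with (INR k * / 2) by (unfold x; field).
    replace (exp (INR k * / 2)) with (exp (/ 2) ^ k).
    - apply pow_incr. split; [left; apply exp_pos|].
      assert (exp (/ 2) * exp (/ 2) <= 3).
      { rewrite <- exp_plus. replace (/ 2 + / 2) with 1 by field. apply exp_le_3. }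
      assert (0 < exp (/ 2)) by apply exp_pos. nra.
    - rewrite <- Rpower_pow by apply exp_pos. unfold Rpower. now rewrite ln_exp. }
  assert (E3 : exp (x / 2) = exp (x / 4) * exp (x / 4)) by (rewrite <- exp_plus; f_equal; field).
  assert (E4 : exp (x / 4) = exp (x / 8) * exp (x / 8)) by (rewrite <- exp_plus; f_equal; field).
  (* exp(x/4) beats 216 (x + 1) because x >= 26896 *)
  assert (E5 := exp_ineq1_le (x / 8)).
  rewrite exp_Ropp in E1.
  set (a := exp (x / 4)) in *.
  assert (Ha : 216 * (x + 1) < a) by (rewrite E4; nra).
  assert (F : / a / 18 <= 12 * (x + 1) / 2 ^ k).
  { unfold Rdiv in T1, T2 |- *. lra. }
  assert (Ha0 : 0 < a) by lra.
  apply (Rmult_le_compat_r (18 * a * 2 ^ k)) in F; [|nra].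
  replace (/ a / 18 * (18 * a * 2 ^ k)) with (2 ^ k) in F by (field; lra).
  replace (12 * (x + 1) / 2 ^ k * (18 * a * 2 ^ k)) with (216 * (x + 1) * a) in F by (field; lra).
  nra.
Qed.

(** * Summing over sparse sets and dyadic blocks *)

Fixpoint window_sum (f : nat -> R) (a len : nat) : R :=
  match len with O => 0 | S l => f a + window_sum f (S a) l end.

Lemma window_sum_app : forall f l l' a,
  window_sum f a (l + l') = window_sum f a l + window_sum f (a + l) l'.
Proof.
  intros f l l'. induction l as [|l IH]; intros a; simpl.
  - rewrite Nat.add_0_r. ring.
  - rewrite IH. replace (S a + l)%nat with (a + S l)%nat by lia. ring.
Qed.

Lemma window_sum_nonneg : forall f, (forall n, 0 <= f n) ->
  forall l a, 0 <= window_sum f a l.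
Proof.
  intros f Hf. induction l as [|l IH]; intros a; simpl; [lra|].
  specialize (IH (S a)). specialize (Hf a). lra.
Qed.

(** For j = 0 this says that values at most M, more than G apart, add up to at
    most M (len / (G + 1) + 1). The parameter j, a number of initial zeros, makes
    the induction on the length go through: after a nonzero value the next G
    values are zero, and a credit of j = G is passed on. *)
Lemma window_sum_spaced : forall (f : nat -> R) (G : nat) (M : R), 0 <= M ->
  forall len a j, (j <= G)%nat ->
  (forall n, (a <= n < a + len)%nat -> f n <= M) ->
  (forall n, (a <= n < a + len)%nat -> (n < a + j)%nat -> f n = 0) ->
  (forall n g, (a <= n)%nat -> (n + g < a + len)%nat -> (1 <= g)%nat ->
     f n <> 0 -> f (n + g)%nat <> 0 -> (G < g)%nat) ->
  window_sum f a len <= M * (INR (len + (G + 1)) - INR j) / INR (G + 1).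
Proof.
  intros f G M HM. induction len as [|len IH]; intros a j Hj Hb Hz Hs.
  - simpl window_sum. apply Rmult_le_pos; [apply Rmult_le_pos; [exact HM|]|].
    + assert (INR j <= INR (0 + (G + 1))) by (apply le_INR; lia). lra.
    + left. apply Rinv_0_lt_compat, lt_0_INR. lia.
  - simpl window_sum.
    assert (HG : 0 < INR (G + 1)) by (apply lt_0_INR; lia).
    assert (Step : forall j', (j' <= G)%nat ->
      (forall n, (S a <= n < S a + len)%nat -> (n < S a + j')%nat -> f n = 0) ->
      window_sum f (S a) len <= M * (INR (len + (G + 1)) - INR j') / INR (G + 1)).
    { intros j' Hj' Hz'. apply IH; [exact Hj'| |exact Hz'|].
      - intros n Hn. apply Hb. lia.
      - intros n g H1 H2. apply Hs; lia. }
    destruct (Req_dec (f a) 0) as [H0|H0].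
    + rewrite H0, Rplus_0_l.
      eapply Rle_trans; [apply (Step (Nat.pred j)); [lia|]|].
      * intros n H1 H2. destruct j; [lia|]. apply Hz; simpl in *; lia.
      * apply Rmult_le_compat_r; [left; now apply Rinv_0_lt_compat|].
        apply Rmult_le_compat_l; [exact HM|].
        replace (S len + (G + 1))%nat with (S (len + (G + 1))) by lia. rewrite S_INR.
        destruct j; [simpl; lra|]. simpl Nat.pred. rewrite S_INR. lra.
    + assert (j = 0%nat) as ->.
      { destruct j; [reflexivity|]. exfalso. apply H0, Hz; lia. }
      assert (HW := Step G (Nat.le_refl G)).
      assert (Hf : f a <= M) by (apply Hb; lia).
      rewrite plus_INR in HW |- *. rewrite S_INR.
      eapply Rle_trans; [apply Rplus_le_compat; [exact Hf|apply HW]|].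
      * intros n H1 H2. destruct (Req_dec (f n) 0) as [|Hne]; [assumption|exfalso].
        assert (G < n - a)%nat; [|lia].
        apply (Hs a (n - a)%nat); try lia; try assumption.
        now replace (a + (n - a))%nat with n by lia.
      * rewrite (plus_INR G 1) in *. simpl (INR 0). simpl (INR 1) in *. right. field. lra.
Qed.

Lemma sum_n_succ : forall (a : nat -> R) n, sum_n a (S n) = sum_n a n + a (S n).
Proof. intros a n. now rewrite sum_Sn. Qed.

Lemma ex_series_nonneg_bounded : forall (a : nat -> R) (M : R),
  (forall n, 0 <= a n) -> (forall n, sum_n a n <= M) -> ex_series a.
Proof.
  intros a M Ha HM.
  destruct (ex_finite_lim_seq_incr (sum_n a) M) as [l Hl].
  - intros n. rewrite sum_n_succ. specialize (Ha (S n)). lra.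
  - exact HM.
  - exists l. exact Hl.
Qed.

Lemma ex_series_dominated : forall (a b : nat -> R),
  (forall n, 0 <= a n <= b n) -> ex_series b -> ex_series a.
Proof.
  intros a b H Hb. apply (ex_series_le (V := R_CompleteNormedModule) a b); [|exact Hb].
  intros n. unfold norm; simpl. unfold abs; simpl. rewrite Rabs_pos_eq; apply H.
Qed.

Lemma sum_n_le_Series : forall (a : nat -> R), (forall n, 0 <= a n) -> ex_series a ->
  forall n, sum_n a n <= Series a.
Proof.
  intros a Ha Hs n. apply Series_correct in Hs.
  apply (is_lim_seq_incr_compare (sum_n a)); [exact Hs|].
  intros m. rewrite sum_n_succ. specialize (Ha (S m)). lra.
Qed.

(** Partial sums stay below 3 - 2 / sqrt (n + 1), by comparison with the
    telescoping differences of 2 / sqrt. *)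
Lemma ex_series_three_halves :
  ex_series (fun k => / (INR (S k) * sqrt (INR (S k)))).
Proof.
  assert (Hp : forall k, 0 < sqrt (INR (S k))) by (intros k; apply sqrt_lt_R0, lt_0_INR; lia).
  apply (ex_series_nonneg_bounded _ 3).
  - intros k. left. apply Rinv_0_lt_compat, Rmult_lt_0_compat; [apply lt_0_INR; lia|apply Hp].
  - assert (H : forall n, sum_n (fun k => / (INR (S k) * sqrt (INR (S k)))) n
                   <= 3 - 2 / sqrt (INR (S n))).
    { induction n as [|n IH].
      - rewrite sum_O. simpl. rewrite sqrt_1. lra.
      - rewrite sum_n_succ.
        assert (A := Hp n). assert (B := Hp (S n)).
        assert (A2 := sqrt_sqrt (INR (S n)) (pos_INR _)).
        assert (B2 := sqrt_sqrt (INR (S (S n))) (pos_INR _)).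
        assert (E := S_INR (S n)).
        set (a := sqrt (INR (S n))) in *. set (b := sqrt (INR (S (S n)))) in *.
        assert (Hab : a <= b) by nra.
        rewrite <- B2.
        assert (K : / (b * b * b) <= 2 / a - 2 / b).
        { replace (2 / a - 2 / b) with (2 * (b * b - a * a) * / (a * b * (a + b))) by (field; lra).
          replace (b * b - a * a) with 1 by lra. rewrite Rmult_1_r.
          apply (Rmult_le_reg_r (b * b * b * (a * b * (a + b)))).
          - repeat apply Rmult_lt_0_compat; lra.
          - replace (/ (b * b * b) * (b * b * b * (a * b * (a + b)))) with (b * (a * (a + b))) by (field; lra).
            replace (2 * / (a * b * (a + b)) * (b * b * b * (a * b * (a + b)))) with (b * (2 * (b * b))) by (field; lra).
            apply Rmult_le_compat_l; [lra|]. nra. }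
        lra. }
    intros n. eapply Rle_trans; [apply H|].
    assert (0 < 2 / sqrt (INR (S n))) by (apply Rmult_lt_0_compat; [lra|apply Rinv_0_lt_compat, Hp]).
    lra.
Qed.

Lemma ex_series_dyadic_blocks : forall (f b : nat -> R), (forall n, 0 <= f n) ->
  (forall k, window_sum f (2 ^ k) (2 ^ k) <= b k) -> ex_series b ->
  ex_series (fun n => f (S n)).
Proof.
  intros f b Hf Hb Hs.
  assert (Hb0 : forall k, 0 <= b k).
  { intros k. eapply Rle_trans; [|apply Hb]. now apply window_sum_nonneg. }
  apply (ex_series_nonneg_bounded _ (Series b)); [intros n; apply Hf|].
  intros n.
  assert (E : sum_n (fun m => f (S m)) n = window_sum f 1 (S n) :> R).
  { induction n as [|n IH].
    - rewrite sum_O. simpl. ring.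
    - rewrite sum_n_succ, IH. replace (S (S n)) with (S n + 1)%nat by lia.
      rewrite window_sum_app. replace (S n + 1)%nat with (S (S n)) by lia. simpl (1 + S n)%nat.
      simpl (window_sum f (S (S n)) 1).
      change (window_sum f 1 (S n) + f (S (S n))
              = window_sum f 1 (S n) + (f (S (S n)) + 0)). ring. }
  rewrite E.
  assert (D : forall K, window_sum f 1 (2 ^ S K - 1) <= sum_n b K).
  { induction K as [|K IH].
    - rewrite sum_O. eapply Rle_trans; [|apply Hb]. simpl. lra.
    - rewrite sum_n_succ.
      assert (HK : (1 <= 2 ^ S K)%nat) by (assert (H := Nat.pow_nonzero 2 (S K)); lia).
      replace (2 ^ S (S K) - 1)%nat with ((2 ^ S K - 1) + 2 ^ S K)%nat
        by (rewrite (Nat.pow_succ_r' 2 (S K)); lia).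
      rewrite window_sum_app. replace (1 + (2 ^ S K - 1))%nat with (2 ^ S K)%nat by lia.
       specialize (Hb (S K)). lra. }
  assert (HN : (S n < 2 ^ S n)%nat) by (apply Nat.pow_gt_lin_r; lia).
  replace (2 ^ S n)%nat with (2 ^ S n - 1 + 1)%nat in HN by lia.
  apply Rle_trans with (window_sum f 1 (2 ^ S n - 1)).
  - replace (2 ^ S n - 1)%nat with (S n + (2 ^ S n - 1 - S n))%nat by lia.
    rewrite window_sum_app.
    assert (W := window_sum_nonneg f Hf (2 ^ S n - 1 - S n) (1 + S n)). lra.
  - eapply Rle_trans; [apply D|]. now apply sum_n_le_Series.
Qed.

(** The reciprocals of the peaks. The absolute value only serves n = 0, where it
    makes the weight nonnegative without evaluating / 0. *)
Definition peak_weight (n : nat) : R :=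
  if Rlt_dec (/ INR n) (bbg_base (INR n) ^ n) then Rabs (/ INR n) else 0.

Lemma peak_weight_neq_0 : forall n, peak_weight n <> 0 ->
  / INR n < bbg_base (INR n) ^ n.
Proof.
  intros n. unfold peak_weight. destruct (Rlt_dec _ _); [auto|congruence].
Qed.

Lemma fourth_root_floor : forall K k : nat, (1 <= K)%nat -> exists s : nat,
  (K * s ^ 4 <= k < K * S s ^ 4)%nat.
Proof.
  intros K k HK. induction k as [|k [s Hs]].
  - exists 0%nat. simpl. lia.
  - destruct (le_lt_dec (K * S s ^ 4) (S k)) as [H|H].
    + exists (S s). split; [exact H|].
      assert (S s ^ 4 < S (S s) ^ 4)%nat by (apply Nat.pow_lt_mono_l; lia). nia.
    + exists s. lia.
Qed.

Definition block_constant : R := 64 * (164 * 164 * 164).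

(** With 164^2 s^4 <= k < 164^2 (s + 1)^4, peaks of the block are more than s^6
    apart, and (s + 1)^6 is at least a constant times (k + 1)^(3/2). *)
Lemma peak_block_sum : forall k, window_sum peak_weight (2 ^ k) (2 ^ k)
  <= block_constant * / (INR (S k) * sqrt (INR (S k))) + (/ 2) ^ k.
Proof.
  intros k.
  assert (Hk : (1 <= 2 ^ k)%nat) by (assert (H := Nat.pow_nonzero 2 k); lia).
  destruct (fourth_root_floor (164 * 164) k ltac:(lia)) as [s [Hs1 Hs2]].
  assert (H2k : INR (2 ^ k) = 2 ^ k) by (rewrite pow_INR; reflexivity).
  assert (H2p : 0 < 2 ^ k) by (apply pow_lt; lra).
  assert (W := window_sum_spaced peak_weight (s ^ 6) (/ 2 ^ k)
    ltac:(left; now apply Rinv_0_lt_compat) (2 ^ k) (2 ^ k) 0 ltac:(lia)).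
  eapply Rle_trans; [apply W|].
  - intros n Hn. unfold peak_weight.
    assert (0 < INR n) by (apply lt_0_INR; lia).
    destruct (Rlt_dec _ _); [|left; now apply Rinv_0_lt_compat].
    rewrite Rabs_pos_eq by (left; now apply Rinv_0_lt_compat).
    apply Rinv_le_contravar; [exact H2p|]. rewrite <- H2k. apply le_INR. lia.
  - intros n Hn Hn0. lia.
  - intros n g Hn Hng Hg A B. apply peak_weight_neq_0 in A. apply peak_weight_neq_0 in B.
    apply (peak_spacing s k n g); try assumption. rewrite Nat.pow_succ_r'. lia.
  - rewrite !plus_INR, H2k, !pow_INR. simpl (INR 0). simpl (INR 1).
    assert (Hs0 := pos_INR s).
    assert (H6 : 0 <= INR s ^ 6) by now apply pow_le.
    replace (/ 2 ^ k * (2 ^ k + (INR s ^ 6 + 1) - 0) / (INR s ^ 6 + 1))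
      with (/ (INR s ^ 6 + 1) + / 2 ^ k) by (field; lra).
    rewrite pow_inv. apply Rplus_le_compat_r.
    set (t := INR s + 1).
    assert (Ht : INR (S s) = t) by (unfold t; now rewrite S_INR).
    assert (T6 : t ^ 6 <= 64 * (INR s ^ 6 + 1)).
    { destruct s as [|s].
      - unfold t. simpl. lra.
      - assert (1 <= INR (S s)) by (apply (le_INR 1); lia).
        apply Rle_trans with ((2 * INR (S s)) ^ 6); [apply pow_incr; unfold t; lra|].
        rewrite Rpow_mult_distr. lra. }
    assert (Hkk : INR (S k) <= 164 * 164 * t ^ 4).
    { apply le_INR in Hs2. rewrite !mult_INR, pow_INR, Ht, (INR_IZR_INZ 164) in Hs2. exact Hs2. }
    assert (Ht1 : 1 <= t) by (unfold t; lra).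
    assert (Hsq : sqrt (INR (S k)) <= 164 * t ^ 2).
    { rewrite <- (sqrt_pow2 (164 * t ^ 2)) by nra. apply sqrt_le_1_alt.
      eapply Rle_trans; [exact Hkk|]. right. ring. }
    assert (HS : 0 < INR (S k)) by (apply lt_0_INR; lia).
    assert (HS2 : 0 < sqrt (INR (S k))) by now apply sqrt_lt_R0.
    set (x := INR (S k)) in *. set (y := sqrt x) in *.
    assert (Hxy : x * y <= 164 * 164 * 164 * t ^ 6).
    { replace (164 * 164 * 164 * t ^ 6) with (164 * 164 * t ^ 4 * (164 * t ^ 2)) by ring.
      apply Rmult_le_compat; lra. }
    assert (Hxy0 : 0 < x * y) by now apply Rmult_lt_0_compat.
    apply (Rmult_le_reg_r ((x * y) * (INR s ^ 6 + 1))); [apply Rmult_lt_0_compat; lra|].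
    replace (/ (INR s ^ 6 + 1) * (x * y * (INR s ^ 6 + 1))) with (x * y) by (field; lra).
    replace (block_constant * / (x * y) * (x * y * (INR s ^ 6 + 1)))
      with (block_constant * (INR s ^ 6 + 1)) by (field; lra).
    unfold block_constant. lra.
Qed.

(** * Convergence of the series *)

Lemma ex_series_plus_R : forall a b : nat -> R, ex_series a -> ex_series b ->
  ex_series (fun n => a n + b n).
Proof. intros a b Ha Hb. exact (ex_series_plus a b Ha Hb). Qed.

Lemma ex_series_scal_R : forall (c : R) (a : nat -> R), ex_series a ->
  ex_series (fun n => c * a n).
Proof. intros c a Ha. exact (ex_series_scal_l c a Ha). Qed.

Lemma ex_series_peak_weight : ex_series1 peak_weight.
Proof.
  apply (ex_series_dyadic_blocks peak_weight _) with (2 := peak_block_sum).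
  - intros n. unfold peak_weight. destruct (Rlt_dec _ _); [apply Rabs_pos|lra].
  - apply ex_series_plus_R.
    + apply ex_series_scal_R, ex_series_three_halves.
    + apply ex_series_geom. rewrite Rabs_pos_eq; lra.
Qed.

Lemma sqrt_INR_S : forall k, 1 <= sqrt (INR (S k)) <= INR (S k).
Proof.
  intros k. assert (H : 1 <= INR (S k)) by (apply (le_INR 1); lia).
  assert (A := sqrt_sqrt (INR (S k)) ltac:(lra)).
  assert (B : 1 <= sqrt (INR (S k))) by (rewrite <- sqrt_1 at 1; apply sqrt_le_1_alt; lra).
  split; [exact B|]. nra.
Qed.

(** A term is at most the weight of a peak, or else at most 1/n^2, which is below
    n^(-3/2). *)
Lemma ex_series_bbg_term : ex_series1 bbg_term.
Proof.
  apply ex_series_dominated with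
    (b := fun k => peak_weight (S k) + / (INR (S k) * sqrt (INR (S k)))).
  2:{ apply ex_series_plus_R; [exact ex_series_peak_weight|exact ex_series_three_halves]. }
  intros k. unfold bbg_term, peak_weight. set (n := S k).
  assert (Hn : 1 <= INR n) by (apply (le_INR 1); unfold n; lia).
  destruct (sqrt_INR_S k) as [Q1 Q2]. fold n in Q1, Q2.
  assert (Hi : 0 < / INR n) by (apply Rinv_0_lt_compat; lra).
  destruct (bbg_base_range (INR n)) as [B1 B2].
  assert (P0 : 0 <= bbg_base (INR n) ^ n) by (apply pow_le; lra).
  assert (P1 : bbg_base (INR n) ^ n <= 1) by (rewrite <- (pow1 n); apply pow_incr; lra).
  assert (R0 : 0 < / (INR n * sqrt (INR n))) by (apply Rinv_0_lt_compat, Rmult_lt_0_compat; lra).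
  replace (1 / INR n) with (/ INR n) by (field; lra).
  split; [apply Rmult_le_pos; lra|].
  destruct (Rlt_dec _ _) as [H|H].
  - rewrite Rabs_pos_eq by lra. nra.
  - apply Rnot_lt_le in H.
    apply Rle_trans with (/ INR n * / INR n); [apply Rmult_le_compat_l; lra|].
    rewrite <- Rinv_mult, Rplus_0_l. apply Rinv_le_contravar; [apply Rmult_lt_0_compat; lra|].
    apply Rmult_le_compat_l; lra.
Qed.

(** Up to 3 pi/2 the distance to pi/2 is at most pi and the quadratic bound for the
    cosine applies; beyond, the sine is negative and the right side is still at
    least 2/3. *)
Lemma bbg_base_quadratic : forall theta, 0 <= theta <= 2 * PI ->
  bbg_base theta <= 1 - (theta - PI / 2) ^ 2 / 121.
Proof.
  intros theta Ht. assert (P0 := PI_RGT_0). assert (P4 := PI_4).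
  unfold bbg_base. destruct (Rle_lt_dec theta (3 * PI / 2)) as [H|H].
  - assert (C := one_minus_cos_ge (theta - PI / 2)).
    replace (cos (theta - PI / 2)) with (sin theta) in C.
    + specialize (C ltac:(apply Rabs_le; lra)).
      assert (0 <= (theta - PI / 2) ^ 2) by apply pow2_ge_0. lra.
    + rewrite <- cos_shift. rewrite <- cos_neg. f_equal. ring.
  - assert (sin theta <= 0) by (apply sin_le_0; lra).
    assert ((theta - PI / 2) ^ 2 <= 36) by nra. lra.
Qed.

Lemma pow_inv_one_plus_le : forall v n, 0 <= v -> (/ (1 + v)) ^ n <= / (1 + INR n * v).
Proof.
  intros v n Hv. rewrite pow_inv. apply Rinv_le_contravar.
  - assert (0 <= INR n * v) by (apply Rmult_le_pos; [apply pos_INR|exact Hv]). lra.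
  - induction n as [|n IH]; [simpl; lra|].
    rewrite S_INR. simpl pow.
    assert (0 <= INR n * v) by (apply Rmult_le_pos; [apply pos_INR|exact Hv]). nra.
Qed.

(** By [bbg_base_quadratic] and Bernoulli's inequality the integrand is at most
    1 / (1 + n d^2 / 121), whose integral is below 11 pi / sqrt n. *)
Lemma I_BBG_bounds : forall n, (1 <= n)%nat -> 0 <= I_BBG n <= 6 / sqrt (INR n).
Proof.
  intros n Hn. assert (P0 := PI_RGT_0).
  assert (Hn1 : 1 <= INR n) by now apply (le_INR 1).
  assert (Hq : 0 < sqrt (INR n)) by (apply sqrt_lt_R0; lra).
  assert (Hqq := sqrt_sqrt (INR n) ltac:(lra)).
  set (q := sqrt (INR n)) in *.
  assert (HP : 0 < 1 / (2 * PI)) by (apply Rmult_lt_0_compat; [lra|apply Rinv_0_lt_compat; lra]).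
  assert (Hex : ex_RInt (fun theta => bbg_base theta ^ n) 0 (2 * PI)).
  { apply (ex_RInt_continuous (V := R_CompleteNormedModule)). intros x _.
    apply (ex_derive_continuous (fun theta : R => bbg_base theta ^ n) x).
    unfold bbg_base. auto_derive. exact I. }
  set (F := fun theta => 11 / q * atan (q / 11 * (theta - PI / 2))).
  set (f := fun theta => / (1 + INR n * ((theta - PI / 2) ^ 2 / 121))).
  assert (Hpos : forall theta, 0 < 1 + INR n * ((theta - PI / 2) ^ 2 / 121)).
  { intros theta. assert (0 <= (theta - PI / 2) ^ 2) by apply pow2_ge_0. nra. }
  assert (Hint : is_RInt f 0 (2 * PI) (F (2 * PI) - F 0)).
  { apply (is_RInt_derive (V := R_CompleteNormedModule) F f).
    - intros x _. unfold F, f. auto_derive; [exact I|].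
      specialize (Hpos x). rewrite <- Hqq in Hpos |- *. unfold Rsqr. field.
      repeat split; lra.
    - intros x _. apply (ex_derive_continuous f x). unfold f. auto_derive.
      specialize (Hpos x). nra. }
  assert (Hle : forall x, 0 < x < 2 * PI -> bbg_base x ^ n <= f x).
  { intros x Hx. set (v := (x - PI / 2) ^ 2 / 121).
    assert (Hv : 0 <= v) by (unfold v; assert (H := pow2_ge_0 (x - PI / 2)); lra).
    eapply Rle_trans; [|apply (pow_inv_one_plus_le v n Hv)].
    apply pow_incr. destruct (bbg_base_range x) as [B1 _]. split; [lra|].
    eapply Rle_trans; [apply bbg_base_quadratic; lra|]. fold v.
    apply (Rmult_le_reg_r (1 + v)); [lra|]. rewrite Rinv_l by lra. nra. }
  unfold I_BBG. split.
  - apply Rmult_le_pos; [lra|]. apply RInt_ge_0; [lra|exact Hex|].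
    intros x _. apply pow_le. destruct (bbg_base_range x). lra.
  - apply Rle_trans with (1 / (2 * PI) * (11 / q * PI)).
    + apply Rmult_le_compat_l; [lra|].
      apply Rle_trans with (RInt f 0 (2 * PI)).
      * apply RInt_le; [lra|exact Hex|eexists; exact Hint|exact Hle].
      * rewrite (is_RInt_unique _ _ _ _ Hint). unfold F.
        assert (A := atan_bound (q / 11 * (2 * PI - PI / 2))).
        assert (B := atan_bound (q / 11 * (0 - PI / 2))).
        rewrite <- Rmult_minus_distr_l. apply Rmult_le_compat_l; [|lra].
        apply Rmult_le_pos; [lra|left; now apply Rinv_0_lt_compat].
    + replace (1 / (2 * PI) * (11 / q * PI)) with (11 / 2 * / q) by (field; lra).
      assert (0 < / q) by now apply Rinv_0_lt_compat. unfold Rdiv. nra.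
Qed.

Lemma ex_series_main_term : ex_series1 main_term.
Proof.
  apply ex_series_dominated with (b := fun k => 6 * / (INR (S k) * sqrt (INR (S k)))).
  2:{ apply ex_series_scal_R, ex_series_three_halves. }
  intros k. unfold main_term.
  destruct (I_BBG_bounds (S k) ltac:(lia)) as [A B].
  assert (Hn : 0 < / INR (S k)) by (apply Rinv_0_lt_compat, lt_0_INR; lia).
  split; [apply Rmult_le_pos; lra|].
  rewrite Rinv_mult. unfold Rdiv in *.
  apply Rle_trans with (6 * / sqrt (INR (S k)) * / INR (S k)); [apply Rmult_le_compat_r; lra|].
  right; ring.
Qed.

Lemma count_below_le : forall x N alpha, (count_below x N alpha <= N)%nat.
Proof.
  intros x N alpha. unfold count_below.
  eapply Nat.le_trans; [apply filter_length_le|]. now rewrite length_seq.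
Qed.

(** For N = 0 the value 1 is attained at alpha = 1. *)
Lemma star_discrepancy_bounds : forall x N,
  0 <= star_discrepancy x N <= 1 /\ (N = O -> star_discrepancy x N = 1).
Proof.
  intros x N. unfold star_discrepancy.
  set (E := fun y => exists alpha, 0 < alpha <= 1 /\
    y = Rabs (INR (count_below x N alpha) / INR N - alpha)).
  destruct (Lub_Rbar_correct E) as [Hub Hleast].
  assert (Hq : forall alpha, 0 <= INR (count_below x N alpha) / INR N <= 1).
  { intros alpha. assert (HC := count_below_le x N alpha).
    destruct N as [|N].
    - replace (count_below x 0 alpha) with 0%nat by lia. simpl (INR 0).
      unfold Rdiv. rewrite Rmult_0_l. lra.
    - apply le_INR in HC. assert (HN : 0 < INR (S N)) by (apply lt_0_INR; lia).
      assert (Hi := Rinv_0_lt_compat _ HN). split.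
      + apply Rmult_le_pos; [apply pos_INR|lra].
      + apply (Rmult_le_reg_r (INR (S N))); [exact HN|].
        unfold Rdiv. rewrite Rmult_assoc, Rinv_l by lra. lra. }
  assert (H1 : E (Rabs (INR (count_below x N 1) / INR N - 1))) by (exists 1; split; [lra|reflexivity]).
  apply Hub in H1.
  assert (H2 : Rbar_le (Lub_Rbar E) 1).
  { apply Hleast. intros y [alpha [Ha ->]]. simpl. specialize (Hq alpha).
    apply Rabs_le. lra. }
  destruct (Lub_Rbar E) as [l| |]; simpl in *; try contradiction.
  split; [split; [|exact H2]|].
  - eapply Rle_trans; [apply Rabs_pos|exact H1].
  - intros ->. apply Rle_antisym; [exact H2|].
    assert (HC := count_below_le x 0 1). replace (count_below x 0 1) with 0%nat in H1 by lia.
    simpl (INR 0) in H1. unfold Rdiv in H1. rewrite Rmult_0_l, Rabs_left in H1 by lra. lra.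
Qed.

Lemma disc_term_bounds : forall k, 0 <= disc_term (S k) <= (2 / 3) ^ k.
Proof.
  intros k. unfold disc_term.
  destruct (star_discrepancy_bounds x_seq (floor_over_2pi (S k))) as [[A B] _].
  set (D := star_discrepancy x_seq (floor_over_2pi (S k))) in *.
  assert (HN : 1 <= INR (S k)) by (apply (le_INR 1); lia).
  assert (Hi : 0 < / INR (S k) <= 1).
  { split; [apply Rinv_0_lt_compat; lra|]. rewrite <- Rinv_1. apply Rinv_le_contravar; lra. }
  assert (P : 0 < (2 / 3) ^ k) by (apply pow_lt; lra).
  rewrite <- (tech_pow_Rmult (2 / 3) k). unfold Rdiv in *. set (p := (2 * / 3) ^ k) in *.
  set (i := / INR (S k)) in *.
  assert (H : 0 <= 2 * / 3 * p * i <= p) by nra. nra.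
Qed.

Lemma ex_series_disc_term : ex_series1 disc_term.
Proof.
  apply ex_series_dominated with (b := fun k => (2 / 3) ^ k); [exact disc_term_bounds|].
  apply ex_series_geom. rewrite Rabs_pos_eq; lra.
Qed.

(** Since 1 < 2 pi, the first term is 2/3 times the discrepancy of the empty set of
    points. *)
Lemma Series1_disc_term_pos : 0 < Series1 disc_term.
Proof.
  apply Rlt_le_trans with (disc_term 1).
  - unfold disc_term.
    assert (E : floor_over_2pi 1 = 0%nat).
    { unfold floor_over_2pi. destruct (base_Int_part (INR 1 / (2 * PI))) as [A _].
      assert (P3 := PI2_3_2).
      assert (INR 1 / (2 * PI) < 1).
      { apply (Rmult_lt_reg_r (2 * PI)); [lra|]. unfold Rdiv.
        rewrite Rmult_assoc, Rinv_l by lra. simpl. lra. }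
      assert (Z : IZR (Int_part (INR 1 / (2 * PI))) < 1) by lra.
      apply lt_IZR in Z. lia. }
    destruct (star_discrepancy_bounds x_seq (floor_over_2pi 1)) as [_ H].
    rewrite (H E). simpl. lra.
  - unfold Series1. rewrite <- (sum_O (fun k => disc_term (S k))).
    apply (sum_n_le_Series (fun k => disc_term (S k))).
    + intros n. apply disc_term_bounds.
    + exact ex_series_disc_term.
Qed.

Theorem theorem4p3 :
  ex_series1 bbg_term /\ ex_series1 main_term /\ ex_series1 rem_term /\
  S_BBG = M_BBG + R_BBG /\
  ex_series1 disc_term /\
  exists c : R, 0 < c /\ Rabs R_BBG <= c * Series1 disc_term.
Proof.
  assert (HS := ex_series_bbg_term). assert (HM := ex_series_main_term).
  assert (HR : ex_series1 rem_term).
  { unfold ex_series1.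
    apply (ex_series_ext (fun k => bbg_term (S k) + -1 * main_term (S k))).
    - intros k. change (@eq R (bbg_term (S k) + -1 * main_term (S k)) (rem_term (S k))).
      unfold bbg_term, main_term, rem_term, Rdiv. ring.
    - apply ex_series_plus_R; [exact HS|apply ex_series_scal_R; exact HM]. }
  repeat split; [exact HS|exact HM|exact HR| |exact ex_series_disc_term|].
  - unfold S_BBG, M_BBG, R_BBG, Series1. rewrite <- Series_plus by assumption.
    apply Series_ext. intros k. unfold bbg_term, main_term, rem_term, Rdiv. ring.
  - assert (HD := Series1_disc_term_pos). assert (HA := Rabs_pos R_BBG).
    exists (Rabs R_BBG / Series1 disc_term + 1). split.
    + assert (0 <= Rabs R_BBG / Series1 disc_term)
        by (apply Rmult_le_pos; [exact HA|left; now apply Rinv_0_lt_compat]). lra.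
    + rewrite Rmult_plus_distr_r. unfold Rdiv. rewrite Rmult_assoc, Rinv_l by lra. lra.
Qed.
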